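(* Let $K$ be a number field and assume that the ABC conjecture holds over $K$. Let $\eta \in \mathcal{O}_K^{*}$ be a unit such that $|\sigma(\eta)|<1$ for all but exactly one embedding $\sigma: K \to \mathbb{C}$, and such that $|\sigma_0(\eta)|>1$ for the one exceptional embedding $\sigma_0$. Then there is a constant $c>0$, depending on $K$ and $\eta$, such that for all sufficiently large $x$ there are at least $c\log x$ prime ideals $\pi$ of $\mathcal{O}_K$ with $N(\pi)\le x$ that are non-Wieferich with respect to $\eta$.
   Context: $\mathcal{O}_K$ is the ring of integers of $K$ and $N(I)=[\mathcal{O}_K:I]$ is the absolute norm of a nonzero ideal $I$. Non-Wieferich primes: a nonzero prime ideal $\pi$ of $\mathcal{O}_K$ is non-Wieferich with respect to a unit $\eta$ if $\eta^{N(\pi)-1}\equiv 1 \pmod{\pi}$ and $\eta^{N(\pi)-1}\not\equiv 1 \pmod{\pi^2}$. ABC conjecture over $K$: let $M_K$ be the set of places of $K$, with $\|\alpha\|_{\mathfrak p}=N(\mathfrak p)^{-v_{\mathfrak p}(\alpha)}$ at a finite place $\mathfrak p$, and with the usual normalized absolute values at archimedean places ($|\sigma(\alpha)|$ for a real place, $|\sigma(\alpha)|^2$ for a complex place). Put $$H(a,b,c)=\Big(\prod_{v\in M_K}\max\{\|a\|_v,\|b\|_v,\|c\|_v\}\Big)^{1/[K:\mathbb{Q}]},\qquad \mathrm{rad}(\alpha)=\Big(\prod_{\mathfrak p\mid \alpha}N(\mathfrak p)^{v_{\mathfrak p}(p)}\Big)^{1/[K:\mathbb{Q}]}$$ for nonzero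 $\alpha\in\mathcal{O}_K$, where the product runs over prime ideals $\mathfrak p$ of $\mathcal{O}_K$ dividing $\alpha$ and $p$ is the rational prime below $\mathfrak p$. The ABC conjecture over $K$ states: for every $\epsilon>0$ there is a constant $C_{\epsilon,K}$ such that $H(a,b,c)\le C_{\epsilon,K}\,\mathrm{rad}(abc)^{1+\epsilon}$ for all nonzero $a,b,c\in\mathcal{O}_K$ with $a+b+c=0$. *)

(* Defs.v *)
From HB Require Import structures.
From mathcomp Require Import all_boot all_order all_algebra all_field.
From mathcomp Require Import finmap complex.
From mathcomp Require Import all_classical all_reals all_analysis.

Set Implicit Arguments.
Unset Strict Implicit.
Unset Printing Implicit Defensive.

Import Order.TTheory GRing.Theory Num.Theory ComplexField.Normc.

Local Open Scope classical_set_scope.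
Local Open Scope ring_scope.
Local Open Scope complex_scope.

(* Number fields are the [K : fieldExtType rat], of degree [\dim {:K}]. *)

Definition algint (K : fieldExtType rat) : {pred K} :=
  fun x => `[< integralOver (intr : int -> K) x >].

Fact algint_subring_closed (K : fieldExtType rat) :
  subring_closed (@algint K).
Proof.
split; first exact/asboolP/(integral1 (intr : {rmorphism int -> K})).
- move=> x y /asboolP xK /asboolP yK.
  exact/asboolP/(integral_sub (RtoK := (intr : {rmorphism int -> K}))).
- move=> x y /asboolP xK /asboolP yK.
  exact/asboolP/(integral_mul (RtoK := (intr : {rmorphism int -> K}))).
Qed.

HB.instance Definition _ (K : fieldExtType rat) :=
  GRing.isSubringClosed.Build K (@algint K) (@algint_subring_closed K).

(* The ring of integers of K. *)
Record OK (K : fieldExtType rat) :=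
  MkOK { oval : K; _ : oval \in @algint K }.

HB.instance Definition _ (K : fieldExtType rat) := [isSub for @oval K].
HB.instance Definition _ (K : fieldExtType rat) := [Choice of OK K by <:].
HB.instance Definition _ (K : fieldExtType rat) :=
  [SubChoice_isSubComNzRing of OK K by <:].

Section Units.
Variable K : fieldExtType rat.

Definition ounit : pred (OK K) :=
  fun x => (val x != 0) && ((val x)^-1 \in @algint K).

Definition oinv (x : OK K) : OK K :=
  if ounit x then insubd x (val x)^-1 else x.

Fact mulVo : {in ounit, left_inverse 1 oinv *%R}.
Proof.
move=> x xU; rewrite /oinv ifT //; move: xU => /andP[x0 xV].
by apply: val_inj; rewrite rmorphM rmorph1 /= insubdK // mulVf.
Qed.

Fact ounitPl (x y : OK K) : y * x = 1 -> ounit x.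
Proof.
move=> /(congr1 val); rewrite rmorphM rmorph1 /= => yx1.
have x0 : val x != 0.
  by apply/eqP => x0; move: yx1; rewrite x0 mulr0 => /esym/eqP; rewrite oner_eq0.
rewrite /ounit x0 /= -[_^-1]mul1r -yx1 mulfK //; exact: valP.
Qed.

Fact oinv_out : {in [predC ounit], oinv =1 id}.
Proof.
by move=> x xU; rewrite /oinv; case: ifP xU => // xU; rewrite !inE /in_mem /= xU.
Qed.

End Units.

HB.instance Definition _ (K : fieldExtType rat) :=
  GRing.ComNzRing_hasMulInverse.Build (OK K)
    (@mulVo K) (@ounitPl K) (@oinv_out K).
HB.instance Definition _ (K : fieldExtType rat) :=
  [SubComUnitRing_isSubIntegralDomain of OK K by <:].

Section Ideals.
Variable K : fieldExtType rat.
Implicit Types (I J P : set (OK K)) (a : OK K).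

(* [idealr_closed] includes properness: [1 \notin P]. *)
Definition nonzero_prime_ideal P : Prop :=
  [/\ idealr_closed [in P], prime_idealr_closed [in P]
    & exists2 a, P a & a != 0].

Definition ideal_mul I J : set (OK K) :=
  [set a | exists s : seq (OK K * OK K),
     (forall u, u \in s -> I u.1 /\ J u.2) /\ a = \sum_(u <- s) u.1 * u.2].

Definition ideal_exp I (n : nat) : set (OK K) := iter n (ideal_mul I) setT.

Definition cosets I : set (set (OK K)) :=
  [set [set b | I (b - a)] | a in [set: OK K]].

(* The index of I in O_K, which is finite for nonzero ideals; [fset_set] is
   empty on infinite sets. *)
Definition ideal_norm I : nat := #|` fset_set (cosets I)|.

(* For a != 0, the n such that P^n divides exactly the ideal (a). *)
Definition valuation P a : nat :=
  xget 0%N [set n | ideal_exp P n a /\ ~ ideal_exp P n.+1 a].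

Definition prime_below P : nat :=
  xget 0%N [set p : nat | prime p /\ P p%:R].

Definition non_wieferich (eta : OK K) P : Prop :=
  P (eta ^+ (ideal_norm P).-1 - 1) /\
  ~ ideal_exp P 2 (eta ^+ (ideal_norm P).-1 - 1).

End Ideals.

Section Heights.
Variables (R : realType) (K : fieldExtType rat).
Implicit Types (P : set (OK K)) (w : K -> R) (a b c : OK K).

Definition finite_abs P a : R :=
  if a == 0 then 0 else (ideal_norm P)%:R ^- valuation P a.

(* An archimedean place is represented by the absolute value |s(.)| induced by
   an embedding s, so that conjugate embeddings give the same place. *)
Definition arch_places : set (K -> R) :=
  [set w | exists s : {rmorphism K -> R[i]}, w = fun x => normc (s x)].

Definition real_place w : Prop :=
  exists s : {rmorphism K -> R}, w = fun x => `|s x|.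

Definition arch_abs w a : R :=
  if `[< real_place w >] then w (val a) else w (val a) ^+ 2.

(* [\big[_/_]_(i \in A)] is the product over the i in A whose factor is not 1,
   of which there are finitely many for nonzero arguments. *)
Definition height a b c : R :=
  ((\big[*%R/1]_(P \in @nonzero_prime_ideal K)
      Num.max (Num.max (finite_abs P a) (finite_abs P b)) (finite_abs P c)) *
   (\big[*%R/1]_(w \in arch_places)
      Num.max (Num.max (arch_abs w a) (arch_abs w b)) (arch_abs w c)))
  `^ (\dim {:K})%:R^-1.

Definition radical a : R :=
  (\big[*%R/1]_(P \in [set P | nonzero_prime_ideal P /\ P a])
      ((ideal_norm P)%:R : R) ^+ valuation P (prime_below P)%:R)
  `^ (\dim {:K})%:R^-1.

Definition abc_conjecture : Prop :=
  forall eps : R, 0 < eps ->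
  exists C : R, forall a b c : OK K,
    a != 0 -> b != 0 -> c != 0 -> a + b + c = 0 ->
    height a b c <= C * radical (a * b * c) `^ (1 + eps).

End Heights.

(* Main.v *)
Require Import Defs.
From HB Require Import structures.
From mathcomp Require Import all_boot all_order all_algebra all_field.
From mathcomp Require Import finmap complex.
From mathcomp Require Import all_classical all_reals all_analysis.
From mathcomp Require Import ring lra zify.
Set Implicit Arguments.
Unset Strict Implicit.
Unset Printing Implicit Defensive.
Import Order.TTheory GRing.Theory Num.Theory ComplexField.Normc.
Local Open Scope classical_set_scope.
Local Open Scope ring_scope.
Local Open Scope complex_scope.

(** Let U_n be the set of primes dividing eta^n - 1 exactly once; they are
non-Wieferich. Since all conjugates of eta but one are small, the norm of
eta^n - 1 is at most 2^d |s0 eta|^n, while the ABC conjecture applied to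
(eta^n - 1) + 1 - eta^n = 0 bounds the product of the norms of the primes
dividing eta^n - 1 from below by almost the same quantity, so these primes
mostly divide only once: the sum of ln N(P) over U_n is at least
(15/16) n ln|s0 eta| - O(1).

A prime of U_n that already occurs in some U_m with m < n occurs in U_g for a
proper divisor g of n. If all primes of U_n are of this kind, the upper bounds
for the proper divisors force their sum to be at least about (15/17) n; but that
sum is at most (3/4) n on average, so a positive proportion of the n contribute
a new prime, of norm O(|s0 eta|^n). This takes the place of the usual argument
with cyclotomic polynomials.

On the algebraic side neither unique factorization nor the invertibility of
ideals is used. O_K has an integral basis (one of minimal discriminant), and
the Smith normal form gives [O_K : c] = |N(c)|. The estimate of the norm then
follows from the Chinese remainder theorem and |O_K / P^2| >= N(P)^2, which only
needs P <> P^2 (Nakayama). The exponents v_P(p) in the radical equal 1 except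
for the finitely many P containing the discriminant. *)

(** * Embeddings *)

Section Embeddings.
Variables (K : fieldExtType rat) (C : numClosedFieldType).
Let d := \dim {:K}.

Lemma separable_field (x : K) : separable_element 1%VS x.
Proof. by apply: pcharf0_separable => i; rewrite pchar_lalg pchar_num. Qed.

Lemma primitive_element : {x : K | <<1%VS; x>>%VS = {:K}%VS}.
Proof.
exists (separable_generator 1%VS {:K}%VS).
rewrite -eq_adjoin_separable_generator ?sub1v //.
by apply/separableP => x _; exact: separable_field.
Qed.

Let th : K := sval primitive_element.

(** Since [th] generates K, every element is [evK q] for some rational [q], and an embedding sending
    [th] to [a] must send [evK q] to [evC a q]. *)
Let evK (q : {poly rat}) : K := (map_poly (in_alg K) q).[th].
Let evC (a : C) (q : {poly rat}) : C := (map_poly ratr q).[a].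

Lemma evK_surj x : exists q, evK q = x.
Proof.
have xth : x \in <<1%VS; th>>%VS by rewrite (svalP primitive_element) memvf.
have /polyOver1P[q qE] := Fadjoin_polyOver 1%VS th x.
by exists q; rewrite /evK -qE Fadjoin_poly_eq.
Qed.

Lemma rational_minpoly : {p : {poly rat} |
  [/\ p \is monic, map_poly (in_alg K) p = minPoly 1%VS th & size p = d.+1]}.
Proof.
have /polyOver1P/cid[q qE] := minPolyOver 1%VS th.
have sq : size q = d.+1.
  rewrite -(size_map_poly (in_alg K)) /= -qE size_minPoly.
  congr _.+1; rewrite /d -(svalP primitive_element) -/th.
  by rewrite dim_Fadjoin dimv1 muln1.
exists q; split=> //.
by rewrite -(map_monic (in_alg K)) -qE monic_minPoly.
Qed.

Let p : {poly rat} := sval rational_minpoly.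

Lemma evK_eq0 q : (evK q == 0) = (p %| q).
Proof.
rewrite /p; case: rational_minpoly => /= p' [pm pE ps].
rewrite -(dvdp_map (in_alg K)) /= pE; apply/idP/idP => [q0|].
  by apply: minPoly_dvdp => //; apply/polyOver1P; exists q.
by move=> /dvdpP[r rE]; rewrite /evK rE hornerM minPolyxx mulr0.
Qed.

Lemma evC_eq (a : C) q r : root (map_poly ratr p) a -> evK q = evK r ->
  evC a q = evC a r.
Proof.
move=> pa qr; apply/eqP; rewrite -subr_eq0 /evC -hornerN -hornerD -rmorphN -rmorphD.
have : p %| q - r by rewrite -evK_eq0 /evK rmorphB hornerD hornerN subr_eq0; apply/eqP.
by move=> /dvdpP[s ->]; rewrite rmorphM hornerM (rootP pa) mulr0.
Qed.

(** By [evC_eq] the value [evC a q] depends only on [evK q]: two representatives differ by a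
    multiple of the minimal polynomial [p]. *)
Lemma embedding_of_root (a : C) : root (map_poly ratr p) a ->
  exists s : {rmorphism K -> C}, s th = a.
Proof.
move=> pa; pose s x := evC a (sval (cid (evK_surj x))).
have sE q : s (evK q) = evC a q.
  by rewrite /s; apply: evC_eq => //; case: cid.
have sB : zmod_morphism s.
  move=> x y; have [[q <-] [r <-]] := (evK_surj x, evK_surj y).
  have -> : evK q - evK r = evK (q - r) by rewrite /evK rmorphB hornerD hornerN.
  by rewrite !sE /evC rmorphB hornerD hornerN.
have sM : monoid_morphism s.
  split=> [|x y].
    have -> : 1 = evK 1 by rewrite /evK rmorph1 hornerC.
    by rewrite sE /evC rmorph1 hornerC.
  have [[q <-] [r <-]] := (evK_surj x, evK_surj y).
  have -> : evK q * evK r = evK (q * r) by rewrite /evK rmorphM hornerM.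
  by rewrite !sE /evC rmorphM hornerM.
pose ms := GRing.isZmodMorphism.Build K C s sB.
pose mm := GRing.isMonoidMorphism.Build K C s sM.
pose f : {rmorphism K -> C} := HB.pack s ms mm.
exists f => /=.
have -> : th = evK 'X by rewrite /evK map_polyX hornerX.
by rewrite sE /evC map_polyX hornerX.
Qed.

Lemma rmorph_evK (s : {rmorphism K -> C}) q : s (evK q) = evC (s th) q.
Proof.
rewrite /evK /evC -horner_map -map_poly_comp; congr _.[_].
by apply: eq_map_poly => x /=; rewrite alg_num_field fmorph_rat.
Qed.

(** The minimal polynomial is separable, so it has d distinct roots in [C], each giving an
    embedding. That the single element [t] separates the embeddings makes a Vandermonde determinant
    nonzero later on. *)
Lemma embeddings : exists (t : K) (e : 'I_d -> {rmorphism K -> C}),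
  [/\ injective (fun i => e i t),
      (forall s : {rmorphism K -> C}, exists i, s =1 e i)
    & forall x, exists c : 'I_d -> rat, x = \sum_i c i *: t ^+ i].
Proof.
have [pm pE ps] : [/\ p \is monic, map_poly (in_alg K) p = minPoly 1%VS th & size p = d.+1].
  by rewrite /p; case: rational_minpoly.
have [r rE] := closed_field_poly_normal (map_poly ratr p : {poly C}).
move: rE; rewrite lead_coef_map (monicP pm) rmorph1 scale1r => rE.
have sp : separable_poly p.
  have := separable_field th; rewrite /separable_element -pE.
  by rewrite separable_map.
have ur : uniq r by rewrite -separable_prod_XsubC -rE separable_map.
have sr : size r = d.
  apply: succn_inj; rewrite -ps -(size_map_poly (ratr : {rmorphism rat -> C})).
  by rewrite rE size_prod_XsubC.
have rP a : (a \in r) = root (map_poly ratr p) a by rewrite rE root_prod_XsubC.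
have ex (i : 'I_d) : exists s : {rmorphism K -> C}, s th = r`_i.
  by apply: embedding_of_root; rewrite -rP mem_nth ?sr.
exists th, (fun i => sval (cid (ex i))); split.
- move=> i j; case: cid => s /= ->; case: cid => s' /= ->.
  by move/eqP; rewrite nth_uniq ?sr // => /eqP/val_inj.
- move=> s.
  have : s th \in r.
    rewrite rP; apply/rootP; rewrite -/(evC (s th) p) -rmorph_evK.
    by apply/eqP; rewrite fmorph_eq0 evK_eq0.
  move=> sr'; have ir : (index (s th) r < d)%N by rewrite -sr index_mem.
  exists (Ordinal ir) => x; case: cid => s' /= s'E.
  have [q <-] := evK_surj x; rewrite !rmorph_evK s'E nth_index //.
- move=> x; have [q] := evK_surj x.
  rewrite -(_ : evK (q %% p) = evK q); last first.
    apply/eqP; rewrite -subr_eq0 /evK -hornerN -hornerD -rmorphN -rmorphD.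
    rewrite -/(evK _) evK_eq0 {2}(divp_eq q p) opprD addrCA subrr addr0.
    by rewrite dvdpNr dvdp_mull.
  move=> <-; exists (fun i => (q %% p)`_i).
  rewrite /evK (@horner_coef_wide _ d); last first.
    rewrite size_map_poly -ltnS -ps ltn_modp; exact: monic_neq0.
  by apply: eq_bigr => i _; rewrite coef_map /= mulr_algl.
Qed.

End Embeddings.

(** The integral equation has integer coefficients, so it can be transported from [C] to [algC],
    where rational algebraic integers are integers. *)
Lemma integral_rat_int (C : numClosedFieldType) (q : rat) :
  integralOver (intr : int -> C) (ratr q) -> exists z : int, q = z%:~R.
Proof.
move=> [p pm pq].
have iE (F : numFieldType) : map_poly (intr : int -> F) p =
    map_poly ratr (map_poly (intr : int -> rat) p).
  by rewrite -map_poly_comp; apply: eq_map_poly => x /=; rewrite ratr_int.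
have pq' : root (map_poly (intr : int -> rat) p) q.
  by move: pq; rewrite iE fmorph_root.
have : (ratr q : algC) \in Num.int.
  apply: Cint_rat_Aint; first exact: rpred_rat.
  apply: (@root_monic_Aint (map_poly intr p)); first by rewrite iE fmorph_root.
    exact: monic_map.
  by apply/polyOverP => i; rewrite coef_map /= intr_int.
move=> /intrP[z zE]; exists z; apply: (fmorph_inj (ratr : {rmorphism rat -> algC})).
by rewrite /= zE ratr_int.
Qed.

(** * Existence of an integral basis *)

Section IntegralBasis.
Variables (K : fieldExtType rat) (C : numClosedFieldType).
Let d := \dim {:K}.

Lemma algint_multiple (x : K) : exists2 m : int, m != 0 & x *~ m \in @algint K.
Proof.
have /polyOver1P[p pE] := minPolyOver 1%VS x.
have pm : p \is monic by rewrite -(map_monic (in_alg K)) -pE monic_minPoly.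
have px : (map_poly (in_alg K) p).[x] = 0 by rewrite -pE minPolyxx.
have [q [m m0 qE]] := rat_poly_scale p; exists m => //.
set n := (size p).-1.
have pn : p`_n = 1 by apply/eqP; exact: pm.
have szp : size p = n.+1 by rewrite /n prednK // size_poly_gt0 monic_neq0.
(* The monic equation of [x *~ m]: multiplying p(x) = 0 by m^n gives it the coefficients p_i
   m^(n-i), which are integers for i < n because [m] clears the denominators. *)
pose P : {poly K} := \poly_(i < n.+1) (in_alg K p`_i * m%:~R ^+ (n - i)).
have Pn : P`_n = 1 by rewrite coef_poly ltnSn pn subnn mulr1 rmorph1.
have szP : size P = n.+1 by rewrite size_poly_eq // pn subnn mulr1 rmorph1 oner_eq0.
apply/asboolP; apply: (@integral_root_monic _ _ (intr : {rmorphism int -> K}) _ P).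
- by rewrite monicE lead_coefE szP Pn.
- apply/rootP; rewrite horner_poly.
  transitivity (m%:~R ^+ n * (map_poly (in_alg K) p).[x]); last by rewrite px mulr0.
  rewrite (@horner_coef_wide _ n.+1) ?size_map_poly ?szp // mulr_sumr.
  apply: eq_bigr => i _; rewrite coef_map -(mulrzl x) exprMn.
  have -> : m%:~R ^+ n = m%:~R ^+ (n - i) * m%:~R ^+ i :> K.
    by rewrite -exprD subnK // -ltnS.
  by rewrite -!mulrA mulrCA; congr (_ * _); rewrite mulrCA.
- move=> y yP; have := elimT (nthP (0 : K)) yP.
  case=> i.
  rewrite szP ltnS => ilen <-; rewrite coef_poly ltnS ilen.
  have [->|iNn] := eqVneq i n.
    by rewrite pn subnn mulr1 rmorph1; apply: (integral1 (intr : {rmorphism int -> K})).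
  have ltin : (i < n)%N by rewrite ltn_neqAle iNn.
  rewrite -subnSK // exprS mulrA -(rmorph_int (in_alg K) m) -rmorphM qE coefZ coef_map.
  rewrite mulrAC mulVf ?intr_eq0 // mul1r !rmorph_int -rmorphXn -rmorphM.
  exact: (integral_id (intr : {rmorphism int -> K})).
Qed.

Variable e : 'I_d -> {rmorphism K -> C}.

(** When n = d and [e] lists the embeddings, the square of the determinant is the discriminant of
    the family [b], nonzero exactly when [b] is free over the rationals. *)
Definition emb_mx n (b : 'I_n -> K) : 'M[C]_(n, d) := \matrix_(i, k) e k (b i).

Lemma emb_mx_comb n (b b' : 'I_n -> K) (M : 'M[rat]_n) :
  (forall i, b' i = \sum_j M i j *: b j) ->
  emb_mx b' = map_mx ratr M *m emb_mx b.
Proof.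
move=> bE; apply/matrixP => i k; rewrite !mxE bE rmorph_sum /=.
by apply: eq_bigr => j _; rewrite !mxE rmorphZ_num.
Qed.

Lemma emb_mx_mul n (b : 'I_n -> K) (x : K) :
  emb_mx (fun i => x * b i) = emb_mx b *m diag_mx (\row_k e k x).
Proof.
apply/matrixP => i k; rewrite !mxE (bigD1 k) //= big1 ?addr0.
  by rewrite !mxE eqxx mulr1n rmorphM mulrC.
by move=> j jk; rewrite !mxE (negbTE jk) mulr0n mulr0.
Qed.

Section Basis.
Variables (b : 'I_d -> K) (b_span : forall x, exists c : 'I_d -> rat, x = \sum_i c i *: b i).
Hypothesis b_free : \det (emb_mx b) != 0.

Lemma mul_matrix (x : K) :
  exists M : 'M[rat]_d, forall i, x * b i = \sum_j M i j *: b j.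
Proof.
have /fin_all_exists[c cE] := fun i => b_span (x * b i).
by exists (\matrix_(i, j) c i j) => i; rewrite cE; apply: eq_bigr => j _; rewrite mxE.
Qed.

Lemma mul_matrix_diag (x : K) (M : 'M[rat]_d) :
  (forall i, x * b i = \sum_j M i j *: b j) ->
  map_mx ratr M *m emb_mx b = emb_mx b *m diag_mx (\row_k e k x).
Proof. by move=> /emb_mx_comb <-; rewrite emb_mx_mul. Qed.

(** By [mul_matrix_diag] the rational matrix of multiplication by [x] is similar to the diagonal
    matrix of the conjugates, so the traces agree. *)
Lemma trace_rat (x : K) : exists q : rat, \sum_k e k x = ratr q.
Proof.
have [M /mul_matrix_diag ME] := mul_matrix x.
exists (\tr M); rewrite rmorph_sum /=.
have -> : \sum_i ratr (M i i) = \tr (map_mx (ratr : rat -> C) M).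
  by apply: eq_bigr => i _; rewrite mxE.
have bu : emb_mx b \in unitmx by rewrite unitmxE unitfE.
rewrite -[map_mx _ _](mulmxK bu) ME -mulmxA mxtrace_mulC mulmxKV //.
by rewrite mxtrace_diag; apply: eq_bigr => k _; rewrite mxE.
Qed.

End Basis.

Hypothesis e_basis : exists b : 'I_d -> K,
  (forall x, exists c : 'I_d -> rat, x = \sum_i c i *: b i) /\ \det (emb_mx b) != 0.

Lemma integral_emb (s : {rmorphism K -> C}) (x : K) :
  x \in @algint K -> integralOver (intr : int -> C) (s x).
Proof.
move=> /asboolP /(integral_rmorph s) [p pm px]; exists p => //.
by move: px; rewrite (eq_map_poly (g := intr)) // => z /=; rewrite rmorph_int.
Qed.

Lemma integralOver_sum (I : Type) (r : seq I) (F : I -> C) :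
  (forall i, integralOver (intr : int -> C) (F i)) ->
  integralOver (intr : int -> C) (\sum_(i <- r) F i).
Proof.
move=> FI; apply: (big_ind (integralOver (intr : int -> C))) => // [|x y].
  exact: (mxpoly.integral0 (intr : {rmorphism int -> C})).
exact: (@integral_add _ _ (intr : {rmorphism int -> C})).
Qed.

Lemma trace_int (x : K) : x \in @algint K -> exists z : int, \sum_k e k x = z%:~R.
Proof.
move=> xI; have [b [bs bf]] := e_basis; have [q qE] := trace_rat bs bf x.
have [z zE] : exists z : int, q = z%:~R.
  apply: (@integral_rat_int C); rewrite -qE; apply: integralOver_sum => k.
  exact: integral_emb.
by exists z; rewrite qE zE ratr_int.
Qed.

(** The product is the Gram matrix of the trace form: its entries are the traces of the
    [b i * b j]. *)
Lemma discr_int (b : 'I_d -> K) : (forall i, b i \in @algint K) ->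
  exists T : 'M[int]_d, emb_mx b *m (emb_mx b)^T = map_mx intr T.
Proof.
move=> bI.
have /fin_all_exists[c cE] (ij : 'I_d * 'I_d) :
    exists z : int, \sum_k e k (b ij.1 * b ij.2) = z%:~R.
  by apply: trace_int; rewrite rpredM ?bI.
exists (\matrix_(i, j) c (i, j)); apply/matrixP => i j; rewrite !mxE -cE.
by apply: eq_bigr => k _; rewrite !mxE rmorphM.
Qed.

Lemma span_of_free (b : 'I_d -> K) : \det (emb_mx b) != 0 ->
  forall x, exists c : 'I_d -> rat, x = \sum_i c i *: b i.
Proof.
move=> bf x; have [b0 [b0s b0f]] := e_basis.
have /fin_all_exists[c cE] := fun i => b0s (b i).
pose M := \matrix_(i, j) c i j : 'M[rat]_d.
have ME i : b i = \sum_j M i j *: b0 j.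
  by rewrite cE; apply: eq_bigr => j _; rewrite mxE.
have Mu : M \in unitmx.
  rewrite unitmxE unitfE; apply: contra bf => /eqP M0.
  by rewrite (emb_mx_comb ME) det_mulmx det_map_mx M0 rmorph0 mul0r.
have [u uE] := b0s x; pose U := \row_j u j *m invmx M.
exists (fun i => U 0 i).
transitivity (\sum_i \sum_j (U 0 i * M i j) *: b0 j); last first.
  apply: eq_bigr => i _; rewrite ME scaler_sumr.
  by apply: eq_bigr => j _; rewrite scalerA.
rewrite exchange_big /= uE; apply: eq_bigr => j _; rewrite -scaler_suml.
have -> : \sum_i U 0 i * M i j = (U *m M) 0 j by rewrite mxE.
by rewrite mulmxKV // mxE.
Qed.

Lemma det_row_replaced n (j : 'I_n) (u : 'rV[rat]_n) :
  \det (\matrix_(i, k) if i == j then u 0 k else (i == k)%:R) = u 0 j.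
Proof.
set A := \matrix_(_, _) _.
rewrite (expand_det_col _ j) (bigD1 j) //= big1 ?addr0; last first.
  by move=> i ij; rewrite mxE (negbTE ij) mul0r.
have -> : cofactor A j j = cofactor 1%:M j j.
  rewrite /cofactor; congr (_ * \det _); apply/matrixP => i k.
  by rewrite !mxE eq_sym (negbTE (neq_lift _ _)).
have -> : cofactor 1%:M j j = (\adj (1%:M : 'M[rat]_n)) j j by rewrite mxE.
by rewrite adj1 !mxE !eqxx mulr1.
Qed.

(** Among bases of algebraic integers, take one with least absolute discriminant. If a coordinate
    [q j] of an algebraic integer [x] were not an integer, replacing [b j] by [x - b j *~ z] with z
    the floor of [q j] would multiply the discriminant by the square of the fractional part of
    [q j], which lies strictly between 0 and 1. *)
Lemma exists_integral_basis : exists b : 'I_d -> K,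
  [/\ forall i, b i \in @algint K, \det (emb_mx b) != 0
    & forall x, x \in @algint K -> exists c : 'I_d -> int, x = \sum_i b i *~ c i].
Proof.
pose P (n : nat) := exists b : 'I_d -> K, [/\ forall i, b i \in @algint K,
  \det (emb_mx b) != 0 & `|\det (emb_mx b) ^+ 2| = n%:R].
have discn (b : 'I_d -> K) : (forall i, b i \in @algint K) ->
    exists n : nat, `|\det (emb_mx b) ^+ 2| = n%:R.
  move=> /discr_int[T /(congr1 determinant)].
  rewrite det_mulmx det_tr -expr2 det_map_mx => ->.
  by exists `|\det T|%N; rewrite -intr_norm -abszE.
have exP : exists n, `[< P n >].
  have [b [bs bf]] := e_basis.
  have /fin_all_exists2[m m0 mI] := fun i => algint_multiple (b i).
  pose b' i := b i *~ m i.
  have b'f : \det (emb_mx b') != 0.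
    have b'E i : b' i = \sum_j (diag_mx (\row_k (m k)%:~R : 'rV[rat]_d)) i j *: b j.
      rewrite (bigD1 i) //= big1 ?addr0 => [|j ij].
        by rewrite !mxE eqxx mulr1n scaler_int.
      by rewrite !mxE eq_sym (negbTE ij) mulr0n scale0r.
    rewrite (emb_mx_comb b'E) det_mulmx mulf_neq0 // det_map_mx det_diag.
    rewrite rmorph_prod; apply/prodf_neq0 => i _.
    by rewrite mxE /= ratr_int intr_eq0.
  have [n nE] := discn b' mI.
  by exists n; apply/asboolP; exists b'.
case: (ex_minnP exP) => n /asboolP[b [bI bf bn]] nmin.
exists b; split => // x xI.
have [q qE] := span_of_free bf x.
exists (fun j => Num.floor (q j)); rewrite {1}qE; apply: eq_bigr => j _.
rewrite -scaler_int; congr (_ *: _); apply/eqP/contraT => qj.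
pose z := Num.floor (q j).
pose b' i := if i == j then x - b j *~ z else b i.
pose u : 'rV[rat]_d := \row_k (if k == j then q j - z%:~R else q k).
have b'E i : b' i = \sum_k (\matrix_(i, k) if i == j then u 0 k else (i == k)%:R) i k *: b k.
  rewrite /b'; case: eqP => [->|/eqP ij].
    rewrite qE (bigD1 j) //= [RHS](bigD1 j) //= !mxE !eqxx scalerBl scaler_int addrAC.
    congr (_ + _); apply: eq_bigr => k kj.
    by rewrite !mxE eqxx (negbTE kj).
  rewrite (bigD1 i) //= big1 ?addr0 => [|k ki]; rewrite mxE (negbTE ij).
    by rewrite eqxx scale1r.
  by rewrite eq_sym (negbTE ki) scale0r.
have b'I i : b' i \in @algint K.
  rewrite /b'; case: ifP => _; last exact: bI.
  by apply: rpredB => //; apply: rpredMz; exact: bI.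
have detE : \det (emb_mx b') = ratr (q j - z%:~R) * \det (emb_mx b).
  by rewrite (emb_mx_comb b'E) det_mulmx det_map_mx det_row_replaced mxE eqxx.
have f0 : q j - z%:~R != 0 by rewrite subr_eq0.
have [m mE] := discn _ b'I.
have : (n <= m)%N.
  apply: nmin; apply/asboolP; exists b'; split=> //.
  by rewrite detE mulf_neq0 // fmorph_eq0.
rewrite -(ler_nat C) -mE -bn detE exprMn [X in _ <= X]normrM.
rewrite ler_pMl ?normr_gt0 ?expf_neq0 //.
have /andP[f1 f2] : 0 <= q j - z%:~R < 1.
  by have /andP[] := floor_itv (q j); rewrite rmorphD /= subr_ge0 ltrBlDl => -> ->.
by rewrite normrX ger0_norm ?ler0q // -(rmorphXn ratr) -(rmorph1 (ratr : {rmorphism rat -> C})) ler_rat leNgt expr_lt1 // f2.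
Qed.

End IntegralBasis.

Lemma integral_basis (K : fieldExtType rat) (C : numClosedFieldType) :
  exists (e : 'I_(\dim {:K}) -> {rmorphism K -> C}) (b : 'I_(\dim {:K}) -> OK K),
  [/\ forall i j, e i =1 e j -> i = j,
      forall s : {rmorphism K -> C}, exists i, s =1 e i,
      \det (emb_mx e (val \o b)) != 0
    & forall x : OK K, exists c : 'I_(\dim {:K}) -> int, x = \sum_i b i *~ c i].
Proof.
have [t [e [inj_e all_e t_span]]] := embeddings K C.
have [|b [bI bf b_span]] := @exists_integral_basis K C e.
  exists (fun i => t ^+ i); split => //.
  have -> : emb_mx e (fun i : 'I_(\dim {:K}) => t ^+ i) =
      Vandermonde _ (\row_k e k t).
    by apply/matrixP => i k; rewrite !mxE rmorphXn.
  rewrite det_Vandermonde; apply/prodf_neq0 => i _; apply/prodf_neq0 => j ij.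
  by rewrite !mxE subr_eq0; apply: contraTneq ij => /inj_e ->; rewrite ltnn.
exists e, (fun i => MkOK (bI i)); split => //.
  by move=> i j eij; apply: inj_e; apply: eij.
move=> x; have [c cE] := b_span (val x) (valP x).
by exists c; apply: val_inj; rewrite raddf_sum cE; apply: eq_bigr => i _; rewrite raddfMz.
Qed.

(** * The ring of integers as a lattice *)

Section Lattice.
Variables (K : fieldExtType rat) (C : numClosedFieldType).
Let d := \dim {:K}.
Variables (e : 'I_d -> {rmorphism K -> C}) (b : 'I_d -> OK K).
Hypothesis b_free : \det (emb_mx e (val \o b)) != 0.
Hypothesis b_span : forall x : OK K, exists c : 'I_d -> int, x = \sum_i b i *~ c i.

Let lin (u : 'rV[int]_d) : OK K := \sum_i b i *~ u 0 i.

Lemma lin_surj x : exists u, x = lin u.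
Proof.
have [c cE] := b_span x; exists (\row_i c i).
by rewrite cE; apply: eq_bigr => i _; rewrite mxE.
Qed.

Lemma linB u v : lin (u - v) = lin u - lin v.
Proof. by rewrite /lin -sumrB; apply: eq_bigr => i _; rewrite !mxE mulrzBr. Qed.

Lemma linZ (n : int) u : lin (n *: u) = lin u *~ n.
Proof. by rewrite /lin mulrz_suml; apply: eq_bigr => i _; rewrite mxE mulrC mulrzA. Qed.

(** Coordinates are row vectors, so [M] acts on the right. The embeddings diagonalize [M] with the
    conjugates of [c] as eigenvalues, whence its determinant is the norm of [c]. *)
Lemma lin_mul (c : OK K) : exists M : 'M[int]_d,
  (forall u, c * lin u = lin (u *m M)) /\ (\det M)%:~R = \prod_k e k (val c).
Proof.
have /fin_all_exists[m mE] := fun i => b_span (c * b i).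
pose M := \matrix_(i, j) m i j : 'M[int]_d.
exists M; split=> [u|].
  rewrite /lin mulr_sumr.
  transitivity (\sum_i \sum_j b j *~ (u 0 i * M i j)).
    apply: eq_bigr => i _; rewrite mulrzAr mE mulrz_suml.
    by apply: eq_bigr => j _; rewrite mxE mulrC mulrzA.
  rewrite exchange_big /=; apply: eq_bigr => j _.
  by rewrite mxE mulrz_sumr.
have ME i : val c * val (b i) = \sum_j map_mx intr M i j *: val (b j).
  rewrite -rmorphM mE raddf_sum; apply: eq_bigr => j _.
  by rewrite raddfMz !mxE scaler_int.
have := emb_mx_comb e ME; rewrite emb_mx_mul => /(congr1 determinant).
rewrite !det_mulmx [RHS]mulrC => /(mulfI b_free).
have -> : map_mx ratr (map_mx intr M) = map_mx intr M :> 'M[C]_d.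
  by apply/matrixP => i j; rewrite !mxE ratr_int.
rewrite det_map_mx => <-; rewrite det_diag; apply: eq_bigr => k _; by rewrite mxE.
Qed.

(** Write [M] as L D Q with D diagonal and L, Q unimodular (Smith normal form). The map [phi] reads
    the coordinates, transformed by the inverse of [Q], modulo the diagonal entries [a i]; its
    target has [|\det M|] elements, the absolute norm of [c]. *)
Lemma finite_index (c : OK K) : c != 0 ->
  exists (T : finType) (phi : OK K -> T),
    (forall x y, phi x = phi y -> exists z, x - y = c * z) /\
    `|\prod_k e k (val c)| = #|T|%:R.
Proof.
move=> c0; have [M [ML Mdet]] := lin_mul c.
have M0 : \det M != 0.
  rewrite -(intr_eq0 C) Mdet; apply/prodf_neq0 => k _; rewrite fmorph_eq0.
  by rewrite -(inj_eq val_inj) in c0.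
have [L uL [Q uQ [s _ ME]]] := int_Smith_normal_form M.
pose a (i : 'I_d) : int := s`_i.
have DE : (\matrix_(i < d, j < d) (s`_i *+ (i == j :> nat))) = diag_mx (\row_i a i).
  by apply/matrixP => i j; rewrite !mxE val_eqE.
rewrite DE in ME.
have detM : `|\det M|%N = (\prod_(i < d) `|a i|)%N.
  rewrite ME !det_mulmx !abszM.
  have abs1 (A : 'M[int]_d) : A \in unitmx -> `|\det A|%N = 1%N.
    by rewrite unitmxE => /orP[] /eqP ->.
  rewrite (abs1 L) // (abs1 Q) // mul1n muln1 det_diag.
  elim/big_ind2: _ => // [m x n y <- <-|i _]; first by rewrite abszM.
  by rewrite mxE.
have s0 (i : 'I_d) : (0 < `|a i|)%N.
  rewrite lt0n; apply/eqP => si; move: M0; rewrite -absz_eq0 detM.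
  by rewrite (bigD1 i) //= si mul0n eqxx.
(* The form [.-1.+1] makes each factor visibly nonempty, as [inord] requires; since [a i] is nonzero
   the cardinal is still [|a i|]. *)
pose T := {dffun forall i : 'I_d, 'I_(`|a i|.-1.+1)}.
have /choice[co coE] := lin_surj.
pose v x := co x *m invmx Q.
pose phi x : T := [ffun i : 'I_d => inord `|(v x (0%R) i %% a i)%Z|%N].
exists T, phi; split=> [x y pxy|]; last first.
  rewrite -Mdet -intr_norm -abszE detM card_dep_ffun foldrE big_map big_enum /=.
  congr (_%:R); apply: eq_bigr => i _; rewrite card_ord prednK //.
have ai0 (i : 'I_d) : a i != 0 by rewrite -absz_gt0.
have vE i : (v x (0%R) i = v y (0%R) i %[mod a i])%Z.
  have := congr1 (fun f : T => val (f i)) pxy; rewrite !ffunE /= !inordK; first last.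
  - rewrite prednK // -ltz_nat gez0_abs ?modz_ge0 //.
    by rewrite abszE ltz_mod.
  - rewrite prednK // -ltz_nat gez0_abs ?modz_ge0 //.
    by rewrite abszE ltz_mod.
  by move/(congr1 Posz); rewrite !gez0_abs ?modz_ge0.
pose w := \row_i (((v x - v y) 0 i)%R %/ a i)%Z.
have wE : v x - v y = w *m diag_mx (\row_i a i).
  apply/rowP => i; transitivity (w 0 i * a i).
    rewrite [w 0 i]mxE divzK //.
    by rewrite mxE [X in _ + X]mxE -eqz_mod_dvd; apply/eqP/vE.
  by rewrite mul_mx_diag !mxE.
exists (lin (w *m invmx L)); rewrite ML ME !mulmxA mulmxKV // -wE mulmxBl !mulmxKV //.
by rewrite linB -!coE.
Qed.

(** * Nilpotent elements modulo a prime number, and the discriminant *)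

Lemma integralOver_mul (u v : C) : integralOver (intr : int -> C) u ->
  integralOver (intr : int -> C) v -> integralOver (intr : int -> C) (u * v).
Proof. exact: (@integral_mul _ _ (intr : {rmorphism int -> C})). Qed.

Lemma integralOver_exp (x : C) n :
  integralOver (intr : int -> C) x -> integralOver (intr : int -> C) (x ^+ n).
Proof.
move=> xI; elim: n => [|n IH].
  by rewrite expr0; exact: (mxpoly.integral1 (intr : {rmorphism int -> C})).
by rewrite exprS; exact: integralOver_mul.
Qed.

(** Nilpotency modulo p is taken in the ring of all algebraic integers of [C], because the
    conjugates of an element of K may lie in different subfields. *)
Let nilp (p : nat) (x : C) := integralOver (intr : int -> C) x /\
  exists m z, integralOver (intr : int -> C) z /\ x ^+ m = p%:R * z.

(** In the binomial expansion of the power m + n, every term contains x^m or y^n. *)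
Lemma nilp_add p x y : nilp p x -> nilp p y -> nilp p (x + y).
Proof.
move=> [xI [m [z [zI xz]]]] [yI [n [w [wI yw]]]].
split; first exact: (@integral_add _ _ (intr : {rmorphism int -> C})).
have /choice[f fE] : forall i : 'I_(m + n).+1, exists u,
    integralOver (intr : int -> C) u /\
    (x ^+ (m + n - i) * y ^+ i) *+ 'C(m + n, i) = p%:R * u.
  move=> i; have [ni|ni] := leqP n i.
    exists (x ^+ (m + n - i) * (w * y ^+ (i - n)) * ('C(m + n, i))%:R); split.
      apply: integralOver_mul; last exact: (integral_nat (intr : {rmorphism int -> C})).
      by apply: integralOver_mul; [|apply: integralOver_mul => //]; apply: integralOver_exp.
    have -> : y ^+ i = p%:R * w * y ^+ (i - n) by rewrite -yw -exprD subnKC.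
    by rewrite -[LHS]mulr_natr -!mulrA mulrCA.
  have le : (m <= m + n - i)%N by rewrite -addnBA ?leq_addr // ltnW.
  exists (z * x ^+ (m + n - i - m) * y ^+ i * ('C(m + n, i))%:R); split.
    apply: integralOver_mul; last exact: (integral_nat (intr : {rmorphism int -> C})).
    by apply: integralOver_mul; [apply: integralOver_mul => //|]; apply: integralOver_exp.
  have -> : x ^+ (m + n - i) = p%:R * z * x ^+ (m + n - i - m).
    by rewrite -xz -exprD subnKC.
  by rewrite -[LHS]mulr_natr -!mulrA.
exists (m + n)%N, (\sum_i f i); split.
  by apply: integralOver_sum => i; case: (fE i).
by rewrite exprDn mulr_sumr; apply: eq_bigr => i _; case: (fE i).
Qed.

(** The conjugates of [x] are nilpotent modulo p, hence so is their sum [t]. Then t^n / p is a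
    rational algebraic integer, so p divides t^n and therefore [t]. *)
Lemma trace_nilp (p : nat) (x : OK K) (t : int) : prime p ->
  (exists m z, x ^+ m = p%:R * z) -> \sum_k e k (val x) = t%:~R -> (p %| t)%Z.
Proof.
move=> pp [m [z xz]] tE.
have : nilp p (\sum_k e k (val x)).
  apply: (big_ind (nilp p)) => [|y w|k _]; last 1 first.
  - split; first exact: integral_emb (valP x).
    exists m, (e k (val z)); split; first exact: integral_emb (valP z).
    by rewrite -rmorphXn -rmorphXn xz !rmorphM !rmorph_nat.
  - split; first exact: (mxpoly.integral0 (intr : {rmorphism int -> C})).
    exists 1%N, 0; split; first exact: (mxpoly.integral0 (intr : {rmorphism int -> C})).
    by rewrite mulr0.
  - exact: nilp_add.
rewrite tE => -[_ [n [w [wI wE]]]].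
have p0 : p%:R != 0 :> rat by rewrite pnatr_eq0 -lt0n prime_gt0.
have [s sE] : exists s : int, ((t ^+ n)%:~R / p%:R : rat) = s%:~R.
  apply: (@integral_rat_int C).
  rewrite fmorph_div /= ratr_int ratr_nat rmorphXn /= wE mulrC mulKf //.
  by rewrite pnatr_eq0 -lt0n prime_gt0.
have : (p %| (t ^+ n)%R)%Z.
  apply/dvdzP; exists s; apply: (@intr_inj rat).
  by rewrite intrM -sE divfK.
by rewrite !dvdzE abszX /= Euclid_dvdX // => /andP[].
Qed.

(** [D] is the absolute determinant of the trace form [T]. If [y] is nilpotent modulo p, so is every
    [y * b j], so the coordinates [u] of [y] satisfy u T = 0 modulo p. The adjugate of [T] turns
    this into (det T) u = 0 modulo p, and u = 0 modulo p unless p divides [D]. *)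
Lemma discriminant : exists D : nat, (D != 0)%N /\
  forall (p : nat) (y : OK K), prime p -> (exists m z, y ^+ m = p%:R * z) ->
  (exists z, y = p%:R * z) \/ (p %| D)%N.
Proof.
have e_basis : exists b : 'I_d -> K,
  (forall x, exists c : 'I_d -> rat, x = \sum_i c i *: b i) /\ \det (emb_mx e b) != 0.
  exists (val \o b); split=> // x; have [m m0 mx] := algint_multiple x.
  have [c cE] := b_span (MkOK mx); exists (fun i => (c i)%:~R / m%:~R).
  have m0' : (m%:~R : rat) != 0 by rewrite intr_eq0.
  apply: (scalerI m0'); rewrite scaler_int (congr1 val cE : x *~ m = _) raddf_sum scaler_sumr.
  by apply: eq_bigr => i _; rewrite raddfMz scalerA mulrC divfK // scaler_int.
have [T TE] := discr_int e_basis (fun i => valP (b i)).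
have T0 : \det T != 0.
  rewrite -(intr_eq0 C) -det_map_mx -TE det_mulmx det_tr mulf_neq0 //.
exists `|\det T|%N; rewrite absz_eq0; split=> // p y pp [m [z yz]].
have [u uE] := lin_surj y.
have tj j : (p %| ((u *m T) 0 j)%R)%Z.
  apply: (@trace_nilp p (y * b j)) => //.
    by exists m, (z * b j ^+ m); rewrite exprMn yz mulrA.
  rewrite mxE rmorph_sum uE.
  transitivity (\sum_i \sum_k (u 0 i)%:~R * (e k (val (b i)) * e k (val (b j)))).
    rewrite exchange_big; apply: eq_bigr => k _.
    rewrite !rmorphM /lin !raddf_sum mulr_suml; apply: eq_bigr => i _.
    by rewrite !raddfMz -mulrzl mulrA.
  apply: eq_bigr => i _; rewrite -mulr_sumr rmorphM; congr (_ * _).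
  have /matrixP/(_ i j) := TE; rewrite !mxE; apply: etrans.
  by apply: eq_bigr => k _; rewrite !mxE.
have [pD|pD] := boolP (p %| `|\det T|)%N; [by right | left].
have /fin_all_exists[w wE] (i : 'I_d) : exists w, u 0 i = w * p%:Z.
  apply/dvdzP.
  have : (p %| (u 0 i * \det T)%R)%Z.
    have -> : u 0 i * \det T = (u *m T *m \adj T) 0 i.
      by rewrite -mulmxA mul_mx_adj mul_mx_scalar mxE mulrC.
    rewrite mxE; apply: rpred_sum => j _; exact: dvdz_mulr.
  by rewrite Gauss_dvdzl // coprimezE /= prime_coprime.
exists (lin (\row_i w i)).
rewrite uE mulr_natl pmulrn -linZ; congr lin; apply/rowP => i.
by rewrite wE !mxE mulrC.
Qed.

End Lattice.

Lemma finite_quotient (K : fieldExtType rat) (c : OK K) : c != 0 ->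
  exists (T : finType) (phi : OK K -> T),
    forall x y, phi x = phi y -> exists z, x - y = c * z.
Proof.
move=> c0; have [e [b [_ _ bf bs]]] := integral_basis K algC.
by have [T [phi [phiP _]]] := finite_index bf bs c0; exists T, phi.
Qed.

Lemma discriminant_exists (K : fieldExtType rat) : exists2 D : nat, D != 0%N &
  forall (p : nat) (y : OK K), prime p -> (exists m z, y ^+ m = p%:R * z) ->
  (exists z, y = p%:R * z) \/ (p %| D)%N.
Proof.
have [e [b [_ _ bf bs]]] := integral_basis K algC.
by have [D [D0 DP]] := discriminant bf bs; exists D.
Qed.

(** * Ideals and residue fields *)

Section Ideals.
Variable K : fieldExtType rat.
Implicit Types (I J P Q : set (OK K)) (a c x y z : OK K).

Definition is_ideal I := I 0 /\ forall a x y, I x -> I y -> I (a * x + y).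

Lemma idealMl I a x : is_ideal I -> I x -> I (a * x).
Proof. by move=> [I0 IM] Ix; rewrite -[_ * _]addr0; apply: IM. Qed.

Lemma idealMr I a x : is_ideal I -> I x -> I (x * a).
Proof. by rewrite mulrC; apply: idealMl. Qed.

Lemma idealD I x y : is_ideal I -> I x -> I y -> I (x + y).
Proof. by move=> [I0 IM] Ix Iy; rewrite -[x]mul1r; apply: IM. Qed.

Lemma idealN I x : is_ideal I -> I x -> I (- x).
Proof. by move=> II Ix; rewrite -mulN1r; apply: idealMl. Qed.

Lemma idealB I x y : is_ideal I -> I x -> I y -> I (x - y).
Proof. by move=> II Ix Iy; apply: idealD => //; apply: idealN. Qed.

Lemma idealBC I x y : is_ideal I -> I (x - y) -> I (y - x).
Proof. by move=> II Ix; rewrite -opprB; apply: idealN. Qed.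

Lemma ideal_trans I x y z : is_ideal I -> I (x - y) -> I (y - z) -> I (x - z).
Proof. by move=> II Ix Iy; rewrite -(subrK y x) -addrA; apply: idealD. Qed.

Lemma ideal_sum I (T : Type) (r : seq T) (F : T -> OK K) :
  is_ideal I -> (forall i, I (F i)) -> I (\sum_(i <- r) F i).
Proof.
by move=> II IF; apply: (big_ind I) => //; [case: II | move=> x y; apply: idealD].
Qed.

Lemma ideal_prod_sub I (T : Type) (r : seq T) (p : pred T) (F G : T -> OK K) :
  is_ideal I -> (forall i, I (F i - G i)) ->
  I (\prod_(i <- r | p i) F i - \prod_(i <- r | p i) G i).
Proof.
move=> II IFG; elim/big_ind2: _ => [|y x t z xy zt|//]; first by rewrite subrr; case: II.
have -> : x * z - y * t = (x - y) * z + y * (z - t) by ring.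
by apply: idealD => //; [apply: idealMr | apply: idealMl].
Qed.

Lemma ideal_expr_sub I x y n : is_ideal I -> I (x - y) -> I (x ^+ n - y ^+ n).
Proof. by move=> II Ixy; rewrite subrXX; apply: idealMr. Qed.

Lemma is_ideal_mul I J : is_ideal I -> is_ideal (ideal_mul I J).
Proof.
move=> II; split; first by exists [::]; rewrite big_nil.
move=> a x y [s [sP ->]] [t [tP ->]].
exists ([seq (a * u.1, u.2) | u <- s] ++ t); split.
  move=> u; rewrite mem_cat => /orP[/mapP[v vs ->]|/tP //].
  by have [? ?] := sP _ vs; split=> //=; apply: idealMl.
rewrite big_cat big_map mulr_sumr; congr (_ + _).
by apply: eq_bigr => u _; rewrite mulrA.
Qed.

Lemma is_ideal_exp I n : is_ideal I -> is_ideal (ideal_exp I n).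
Proof. by case: n => [|n] II; [split | exact: is_ideal_mul]. Qed.

Lemma ideal_mul_subr I J : is_ideal J -> ideal_mul I J `<=` J.
Proof.
move=> IJ _ [s [sP ->]]; rewrite big_seq.
apply: (big_ind J); [by case: IJ | by move=> ? ?; apply: idealD |].
by move=> u /sP[_ Ju]; apply: idealMl.
Qed.

Lemma ideal_mul_subl I J : is_ideal I -> ideal_mul I J `<=` I.
Proof.
move=> II _ [s [sP ->]]; rewrite big_seq.
apply: (big_ind I); [by case: II | by move=> ? ?; apply: idealD |].
by move=> u /sP[Iu _]; apply: idealMr.
Qed.

Lemma mem_ideal_mul I J x y : I x -> J y -> ideal_mul I J (x * y).
Proof.
move=> Ix Jy; exists [:: (x, y)]; rewrite big_seq1; split=> // u.
by rewrite inE => /eqP ->.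
Qed.

Lemma ideal_expS_sub I n : is_ideal I -> ideal_exp I n.+1 `<=` ideal_exp I n.
Proof. by move=> II; exact: (@ideal_mul_subr I _ (is_ideal_exp n II)). Qed.

Lemma ideal_exp_sub I m n : is_ideal I -> (m <= n)%N -> ideal_exp I n `<=` ideal_exp I m.
Proof.
move=> II; elim: n => [|n IH]; first by rewrite leqn0 => /eqP -> x.
rewrite leq_eqVlt ltnS => /orP[/eqP -> x //|/IH nm] x /(ideal_expS_sub II).
exact: nm.
Qed.

Lemma ideal_exp1 I : is_ideal I -> ideal_exp I 1 = I.
Proof.
move=> II; apply/seteqP; split; first exact: ideal_mul_subl.
by move=> x Ix; rewrite -[x]mulr1; apply: mem_ideal_mul.
Qed.

Lemma ideal_exp2_sub I : is_ideal I -> ideal_exp I 2 `<=` I.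
Proof. by move=> II; rewrite -{2}(ideal_exp1 II); apply: ideal_expS_sub. Qed.

Lemma mem_ideal_exp2 I x y : is_ideal I -> I x -> I y -> ideal_exp I 2 (x * y).
Proof.
move=> II Ix Iy; apply: mem_ideal_mul => //.
by change (ideal_exp I 1 y); rewrite ideal_exp1.
Qed.

Lemma prime_is_ideal P : nonzero_prime_ideal P -> is_ideal P.
Proof.
move=> [[P0 _ PM] _ _]; split; first by move: P0; rewrite inE.
by move=> a x y Px Py; have := PM a x y; rewrite !inE; apply.
Qed.

Lemma prime_not1 P : nonzero_prime_ideal P -> ~ P 1.
Proof. by move=> [[_ P1 _] _ _] ?; move/negP: P1; apply; rewrite inE. Qed.

Lemma prime_mul P x y : nonzero_prime_ideal P -> P (x * y) -> P x \/ P y.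
Proof.
move=> [_ PP _] Pxy; have := PP x y; rewrite !inE => /(_ Pxy) /orP.
by rewrite !inE.
Qed.

Lemma prime_unit P x : nonzero_prime_ideal P -> x \is a GRing.unit -> ~ P x.
Proof.
move=> PP xu Px; apply: (prime_not1 PP); rewrite -(mulrV xu).
by apply: idealMr => //; exact: prime_is_ideal.
Qed.

(** * Residue classes and the norm of a prime ideal *)

Definition coset I a : set (OK K) := [set b | I (b - a)].

Lemma coset_eq I a b : is_ideal I -> (coset I a = coset I b) <-> I (a - b).
Proof.
move=> II; split=> [ab|Iab].
  have : coset I a a by rewrite /coset /= subrr; case: II.
  by rewrite ab.
apply/seteqP; split=> x; rewrite /coset /= => Ix.
  exact: ideal_trans Ix Iab.
exact: ideal_trans Ix (idealBC II Iab).
Qed.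

(** Congruence modulo [c] refines congruence modulo [I], so [phi a] determines the coset of [a]. *)
Lemma finite_cosets I c : is_ideal I -> c != 0 -> I c -> finite_set (cosets I).
Proof.
move=> II c0 Ic; have [T [phi phiP]] := finite_quotient c0.
pose f (t : T) : set (OK K) := [set b | exists2 a, phi a = t & I (b - a)].
apply: (@sub_finite_set _ _ (f @` setT)); last exact/finite_image/finite_finset.
move=> _ [a _ <-]; exists (phi a) => //.
apply/seteqP; split=> x /=; last by exists a.
move=> [b /phiP[z bz] Ix]; apply: ideal_trans Ix _ => //.
by rewrite bz; apply: idealMr.
Qed.

(** Turns the cardinal [ideal_norm] into a complete system of representatives. Finiteness of the
    cosets matters, since [fset_set] would be empty otherwise. *)
Lemma residue_reps P : nonzero_prime_ideal P ->
  exists r : 'I_(ideal_norm P) -> OK K,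
    (forall i j, P (r i - r j) -> i = j) /\ forall x, exists i, P (x - r i).
Proof.
move=> PP; have PI := prime_is_ideal PP; have [_ _ [c Pc c0]] := PP.
have fin := finite_cosets PI c0 Pc.
set s := enum_fset (fset_set (cosets P)).
have sE : size s = ideal_norm P by [].
have sP A : (A \in s) = (A \in cosets P) by rewrite -in_fset_set.
have /choice[r rE] (i : 'I_(ideal_norm P)) : exists a, coset P a = nth set0 s i.
  have : nth set0 s i \in s by rewrite mem_nth // sE.
  by rewrite sP inE => -[a _ aE]; exists a.
exists r; split=> [i j /(coset_eq _ _ PI)|x].
  rewrite !rE => /eqP; rewrite nth_uniq ?sE //; first by move/eqP/val_inj.
  exact: fset_uniq.
have : coset P x \in s by rewrite sP inE; exists x.
move=> xs; have ix : (index (coset P x) s < ideal_norm P)%N by rewrite -sE index_mem.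
by exists (Ordinal ix); apply/(coset_eq _ _ PI); rewrite rE /= nth_index.
Qed.

Section ResidueField.
Variables (P : set (OK K)) (PP : nonzero_prime_ideal P).
Let N := ideal_norm P.
Let PI := prime_is_ideal PP.

Lemma ideal_norm_gt1 : (1 < N)%N.
Proof.
have [r [r_inj r_surj]] := residue_reps PP.
have [i iP] := r_surj 0; have [j jP] := r_surj 1.
case: ltnP => // N1; exfalso; apply: (prime_not1 PP).
have ij : i = j.
  apply: val_inj; have := leq_trans (ltn_ord i) N1.
  by have := leq_trans (ltn_ord j) N1; rewrite !ltnS !leqn0 => /eqP /= -> /eqP ->.
rewrite -[1]subr0; apply: (ideal_trans PI jP); rewrite -ij; exact: idealBC.
Qed.

(** Adding 1 permutes the residue classes, so the sum of the representatives is congruent to itself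
    plus [N]. *)
Lemma ideal_norm_mem : P N%:R.
Proof.
have [r [r_inj r_surj]] := residue_reps PP.
have /choice[t tE] := fun i => r_surj (r i + 1).
have t_inj : injective t.
  move=> i j tij; apply: r_inj.
  have -> : r i - r j = (r i + 1) - (r j + 1) by ring.
  apply: (ideal_trans PI (tE i)); rewrite tij; exact: (idealBC PI (tE j)).
have := ideal_sum (index_enum _) PI tE.
rewrite sumrB [X in _ - X](_ : _ = \sum_i r i); last first.
  by rewrite [RHS](reindex_inj t_inj).
by rewrite big_split /= addrAC subrr add0r sumr_const card_ord.
Qed.

(** Multiplication by [a] permutes the nonzero classes; the product of their representatives is
    outside [P] and cancels. *)
Lemma fermat_residue a : ~ P a -> P (a ^+ N.-1 - 1).
Proof.
move=> Pa; have [r [r_inj r_surj]] := residue_reps PP.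
have /choice[t tE] := fun i => r_surj (a * r i).
have t_inj : injective t.
  move=> i j tij; apply: r_inj.
  have : P (a * (r i - r j)).
    rewrite mulrBr; apply: (ideal_trans PI (tE i)); rewrite tij.
    exact: (idealBC PI (tE j)).
  by case/(prime_mul PP).
have [i0 i0P] := r_surj 0.
have r0 i : (i == i0) = `[< P (r i) >].
  apply/eqP/asboolP => [->|Pri]; first by have := idealN PI i0P; rewrite opprB subr0.
  by apply: r_inj; apply: ideal_trans i0P => //; rewrite subr0.
have t0 i : (t i != i0) = (i != i0).
  congr (~~ _); rewrite !r0; apply/asbool_equiv_eq; split=> [Pti|Pi].
    have : P (a * r i).
      by rewrite -[_ * _]subr0; apply: (ideal_trans PI (tE i)); rewrite subr0.
    by case/(prime_mul PP).
  rewrite -[r _]subr0; apply: (ideal_trans PI (idealBC PI (tE i))); rewrite subr0.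
  exact: idealMl.
have := ideal_prod_sub (index_enum _) (fun i => i != i0) PI tE.
rewrite [X in _ - X](_ : _ = \prod_(i | i != i0) r i); last first.
  by rewrite [RHS](reindex_inj t_inj) /=; apply: eq_bigl => i; rewrite t0.
rewrite big_split /= prodr_const cardC1 card_ord -/N -[X in _ - X]mul1r -mulrBl.
case/(prime_mul PP) => // Pprod; exfalso; move: Pprod.
apply: (big_ind (fun x => ~ P x)) => [|x y Px Py|i].
- exact: prime_not1.
- by case/(prime_mul PP).
- by rewrite r0 => /asboolP.
Qed.

Lemma prime_maximal a : ~ P a -> exists y, P (a * y - 1).
Proof.
move=> /fermat_residue Pa; exists (a ^+ N.-2); rewrite -exprS.
by rewrite prednK // -subn1 subn_gt0 ideal_norm_gt1.
Qed.

(** With [y] inverse to [a] modulo [P], the error [(a * y - 1) * x] is a product of two elements of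
    [P]. *)
Lemma prime_primary a x : ~ P a -> P x -> ideal_exp P 2 (a * x) -> ideal_exp P 2 x.
Proof.
move=> /prime_maximal[y Py] Px Pax.
have -> : x = y * (a * x) - (a * y - 1) * x by ring.
apply: idealB; first exact: is_ideal_exp.
  by apply: idealMl => //; exact: is_ideal_exp.
exact: mem_ideal_exp2.
Qed.

(** Starting from [N], split off prime factors from a positive integer in [P] until one of them lies
    in [P]; the cofactor decreases. *)
Lemma prime_below_exists : exists p, prime p /\ P p%:R.
Proof.
have : (0 < N)%N by exact: ltnW ideal_norm_gt1.
move: N ideal_norm_mem => n; have [k] := ubnP n; elim: k n => // k IH n.
rewrite ltnS => nk Pn n0; have [n1|n1] := leqP n 1.
  by case: (prime_not1 PP); rewrite (_ : 1 = n%:R) //; case: n n0 n1 {nk Pn} => [|[]].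
have pn := pdiv_prime n1.
move: Pn; rewrite -(divnK (pdiv_dvd n)) natrM.
case/(prime_mul PP) => [Pm|Pp]; last by exists (pdiv n).
apply: IH Pm _; last by rewrite divn_gt0 ?prime_gt0 // dvdn_leq // pdiv_dvd.
by apply: leq_trans nk; rewrite ltn_Pdiv // prime_gt1.
Qed.

Lemma prime_belowP : prime (prime_below P) /\ P (prime_below P)%:R.
Proof.
by rewrite /prime_below; case: xgetP => [x -> //|]; have [p pP] := prime_below_exists => /(_ p).
Qed.

End ResidueField.

End Ideals.

(** * Products of primes *)

Section Primes.
Variable K : fieldExtType rat.
Implicit Types (I J P Q : set (OK K)) (a c x y z : OK K).

(** The generators are [c] and one element of [I] from each class modulo [c] that [I] meets; classes
    it misses get the dummy generator 0. *)
Lemma ideal_finite_gen I c : is_ideal I -> c != 0 -> I c ->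
  exists n (g : 'I_n -> OK K), (forall i, I (g i)) /\
    forall x, I x -> exists a : 'I_n -> OK K, x = \sum_i a i * g i.
Proof.
move=> II c0 Ic; have [T [phi phiP]] := finite_quotient c0.
have /choice[r rE] (t : T) : exists x, I x /\ forall y, I y -> phi y = t -> phi x = t.
  have [[x Ix xt]|nt] := pselect (exists2 x, I x & phi x = t); first by exists x.
  exists 0; split=> [|y Iy yt]; first by case: II.
  by case: nt; exists y.
pose s := c :: [seq r t | t <- enum T].
exists (size s), (fun i => nth 0 s i); split=> [i|x Ix].
  have : nth 0 s i \in s by rewrite mem_nth.
  by rewrite inE => /orP[/eqP ->//|/mapP[t _ ->]]; case: (rE t).
have xr : phi x = phi (r (phi x)).
  by have [_ rx] := rE (phi x); rewrite (rx x).
have [z xz] := phiP _ _ xr.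
have it : (index (phi x) (enum T) < size (enum T))%N by rewrite index_mem mem_enum.
have jlt : ((index (phi x) (enum T)).+1 < size s)%N by rewrite /= size_map.
(* [x] is [c * z] plus the representative of its class, whose index is shifted by one because [c]
   heads the list [s]. *)
exists (fun i => if val i == 0%N then z else (val i == (index (phi x) (enum T)).+1)%:R).
rewrite (bigD1 (Ordinal (ltn0Sn _))) //= (bigD1 (Ordinal jlt)) //= eqxx big1 ?addr0.
  by rewrite (nth_map (phi x)) // nth_index ?mem_enum // mul1r mulrC -xz subrK.
by move=> i; rewrite -!val_eqE => /andP[/= /negbTE -> /negbTE ->]; rewrite mul0r.
Qed.

(* Nakayama's lemma, by eliminating the generators of P one at a time. *)
Lemma prime_neq_square P : nonzero_prime_ideal P ->
  exists z, P z /\ ~ ideal_exp P 2 z.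
Proof.
move=> PP; apply: contrapT => noz; have PI := prime_is_ideal PP.
have PP2 x : P x -> ideal_exp P 2 x.
  by move=> Px; apply: contrapT => Px2; apply: noz; exists x.
have [_ _ [c Pc c0]] := PP.
have [n [g [gP g_gen]]] := ideal_finite_gen PI c0 Pc.
have comb x : P x -> exists a : 'I_n -> OK K, (forall i, P (a i)) /\ x = \sum_i a i * g i.
  move=> /PP2[s [sP ->]].
  have {}sP u : u \in s -> P u.1 /\ P u.2.
    by move=> /sP[Pu1 Pu2]; split=> //; exact: (ideal_mul_subl PI Pu2).
  elim: s sP => [|u s IH] sP.
    exists (fun _ => 0); rewrite big_nil; split=> [i|]; first by case: PI.
    by rewrite big1 // => i _; rewrite mul0r.
  have [|a [aP aE]] := IH; first by move=> v vs; apply: sP; rewrite inE vs orbT.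
  have [Pu1 /g_gen[b bE]] := sP u (mem_head _ _).
  exists (fun i => u.1 * b i + a i); split=> [i|].
    apply: (idealD PI) => //. exact: (idealMr _ PI).
  rewrite big_cons aE {1}bE mulr_sumr -big_split /=.
  by apply: eq_bigr => i _; rewrite mulrDl mulrA.
(* After k eliminations a multiplier [e], congruent to 1 modulo [P], sends [P] into the combinations
   of the first n - k generators. For k = n it kills the nonzero [c], so [e] is 0 and [P] contains
   1. *)
have elimk k : (k <= n)%N -> exists e, P (e - 1) /\ forall x, P x ->
    exists a : 'I_n -> OK K, (forall i, P (a i)) /\
      e * x = \sum_(i < n | (i < n - k)%N) a i * g i.
  elim: k => [_|k IH kn].
    exists 1; split=> [|x /comb[a [aP aE]]]; first by rewrite subrr; case: PI.
    exists a; split=> //; rewrite mul1r aE; apply: eq_bigl => i.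
    by rewrite subn0 ltn_ord.
  have [e [e1 eE]] := IH (ltnW kn).
  have jlt : (n - k.+1 < n)%N by rewrite ltn_subrL /= (leq_trans _ kn).
  pose j := Ordinal jlt.
  have split_j (F : 'I_n -> OK K) : \sum_(i < n | (i < n - k)%N) F i =
      F j + \sum_(i < n | (i < n - k.+1)%N) F i.
    rewrite (bigD1 j) /=; last by rewrite subnSK.
    congr (_ + _); apply: eq_bigl => i.
    by rewrite -(inj_eq val_inj) /= -(subnSK kn) ltnS ltn_neqAle andbC.
  have [a [aP]] := eE _ (gP j); rewrite split_j => aE.
  (* By [aE], the factor [e - a j] sends [g j] into the span of the remaining generators; the new
     multiplier is still 1 modulo [P] because [a j] lies in [P]. *)
  exists (e * (e - a j)); split.
    have -> : e * (e - a j) - 1 = (e - 1) * (e + 1) - e * a j by ring.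
    apply: (idealB PI); [exact: (idealMr _ PI e1) | exact: (idealMl _ PI (aP j))].
  move=> x /eE[b [bP]]; rewrite split_j => bE.
  exists (fun i => (e - a j) * b i + b j * a i); split=> [i|].
    by apply: (idealD PI); apply: (idealMl _ PI).
  transitivity ((e - a j) * (e * x)); first by ring.
  rewrite bE mulrDr mulrCA mulrBl aE addrAC subrr add0r.
  rewrite !mulr_sumr addrC -big_split /=.
  by apply: eq_bigr => i _; ring.
have [e [e1 eE]] := elimk n (leqnn n).
have [a [_]] := eE _ Pc.
rewrite big_pred0 => [|i]; last by rewrite subnn.
move=> /eqP; rewrite mulf_eq0 (negbTE c0) orbF => /eqP e0.
apply: (prime_not1 PP); have := idealN PI e1.
by rewrite e0 sub0r opprK.
Qed.

(** A lower bound for the index of [I], certified by n pairwise incongruent elements. *)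
Definition index_ge I (n : nat) := exists (T : finType) (f : T -> OK K),
  #|T| = n /\ forall i j, I (f i - f j) -> i = j.

Lemma index_ge_norm P : nonzero_prime_ideal P -> index_ge P (ideal_norm P).
Proof.
move=> PP; have [r [r_inj _]] := residue_reps PP.
by exists _, r; rewrite card_ord.
Qed.

(** For [z] in [P] outside its square, the elements [r i + z * r j] are pairwise incongruent modulo
    the square: reduction modulo [P] recovers i, then [prime_primary] recovers j. *)
Lemma index_ge_square P : nonzero_prime_ideal P ->
  index_ge (ideal_exp P 2) (ideal_norm P ^ 2).
Proof.
move=> PP; have PI := prime_is_ideal PP; have [r [r_inj _]] := residue_reps PP.
have [z [Pz Pz2]] := prime_neq_square PP.
exists ('I_(ideal_norm P) * 'I_(ideal_norm P))%type, (fun u => r u.1 + z * r u.2).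
rewrite card_prod card_ord; split=> // -[i j] [i' j'] /= H.
have E : r i + z * r j - (r i' + z * r j') = (r i - r i') + (r j - r j') * z by ring.
have ii' : i = i'.
  apply: r_inj; have := ideal_exp2_sub PI H; rewrite E => H'.
  have := idealB PI H' (idealMl (r j - r j') PI Pz); rewrite addrK; exact.
subst i'; congr (_, _); move: H; rewrite E subrr add0r => H.
have [Pj|Pj] := pselect (P (r j - r j')); first exact: r_inj.
by case: Pz2; exact: (prime_primary PP Pj Pz H).
Qed.

Definition comaximal I J := exists u v, [/\ I u, J v & u + v = 1].

Lemma comaximalC I J : comaximal I J -> comaximal J I.
Proof. by move=> [u [v [Iu Jv uv]]]; exists v, u; rewrite addrC. Qed.

Lemma comaximal_primes P Q : nonzero_prime_ideal P -> nonzero_prime_ideal Q ->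
  P <> Q -> comaximal P Q.
Proof.
move=> PP QP PQ; have PI := prime_is_ideal PP; have QI := prime_is_ideal QP.
have notsub (P' Q' : set (OK K)) : nonzero_prime_ideal P' -> nonzero_prime_ideal Q' ->
    ~ (Q' `<=` P') -> comaximal P' Q'.
  move=> P'P Q'P /existsNP[a /not_implyP[Qa Pa]].
  have [y Py] := prime_maximal P'P Pa.
  exists (- (a * y - 1)), (a * y); split; last by ring.
    exact: (idealN (prime_is_ideal P'P) Py).
  exact: (idealMr _ (prime_is_ideal Q'P) Qa).
have [QsP|/(notsub _ _ PP QP)//] := pselect (Q `<=` P).
apply/comaximalC/notsub => // PsQ; apply: PQ; exact/seteqP.
Qed.

Lemma comaximal_exp2 I J : is_ideal I -> is_ideal J -> comaximal I J ->
  comaximal (ideal_exp I 2) J.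
Proof.
move=> II IJ [u [v [Iu Jv uv]]]; exists (u * u), (v * (1 + u)); split.
- exact: mem_ideal_exp2.
- exact: (idealMr _ IJ Jv).
- have -> : v = 1 - u by rewrite -uv addrAC subrr add0r.
  by ring.
Qed.

(** Chinese remainder theorem: [f i * v + h j * u] is congruent to [f i] modulo [I] and to [h j]
    modulo [J]. *)
Lemma index_geI I J m n : is_ideal I -> is_ideal J -> comaximal I J ->
  index_ge I m -> index_ge J n -> index_ge (I `&` J) (m * n).
Proof.
move=> II IJ [u [v [Iu Jv uv]]] [T [f [Tm f_inj]]] [S [h [Sn h_inj]]].
have uE : u = 1 - v by rewrite -uv addrK.
exists (T * S)%type, (fun i => f i.1 * v + h i.2 * u).
rewrite card_prod Tm Sn; split=> // -[i j] [i' j'] /= [HI HJ].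
congr (_, _).
  apply: f_inj.
  have -> : f i - f i' = (f i * v + h j * u - (f i' * v + h j' * u)) +
      (f i - f i' - (h j - h j')) * u by rewrite uE; ring.
  by apply: (idealD II) => //; apply: (idealMl _ II).
apply: h_inj.
have -> : h j - h j' = (f i * v + h j * u - (f i' * v + h j' * u)) +
    (h j - h j' - (f i - f i')) * v by rewrite uE; ring.
by apply: (idealD IJ) => //; apply: (idealMl _ IJ).
Qed.

Lemma index_ge_bigcap (A : eqType) (s : seq A) (Q : A -> set (OK K)) (n : A -> nat) :
  (forall i, i \in s -> is_ideal (Q i) /\ index_ge (Q i) (n i)) -> uniq s ->
  (forall i j, i \in s -> j \in s -> i <> j -> comaximal (Q i) (Q j)) ->
  index_ge [set x | forall i, i \in s -> Q i x] (\prod_(i <- s) n i).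
Proof.
elim: s => [|i s IH] sQ us co.
  rewrite big_nil; exists unit, (fun _ => 0); rewrite card_unit; split=> //.
  by move=> [] [].
move: us => /= /andP[iNs us].
have sI j : j \in s -> is_ideal (Q j).
  by move=> js; case: (sQ j) => //; rewrite inE js orbT.
have [iI in_] := sQ i (mem_head _ _).
have capI (t : seq A) : {subset t <= s} -> is_ideal [set x | forall j, j \in t -> Q j x].
  move=> ts; split=> [j /ts/sI[]//|a x y Hx Hy j jt].
  by have [_ ] := sI _ (ts _ jt); apply; [apply: Hx | apply: Hy].
have -> : [set x | forall j, j \in i :: s -> Q j x] =
    Q i `&` [set x | forall j, j \in s -> Q j x].
  apply/seteqP; split=> x /= Hx.
    split=> [|j js]; first by apply: Hx; rewrite mem_head.
    by apply: Hx; rewrite inE js orbT.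
  by move=> j; rewrite inE => /orP[/eqP ->|]; [case: Hx | case: Hx => _; apply].
rewrite big_cons; apply: index_geI => //; first exact: capI.
  (* [Q i] is comaximal with the intersection over any sublist [t] of [s]: by induction on [t],
     expand the product of two decompositions of 1. *)
  have: {subset s <= s} by [].
  move: {1 3}s => t; elim: t => [_|j t IHt jts].
    by exists 0, 1; split; [case: iI | | rewrite add0r].
  have [|u [v [Qu Hv uv]]] := IHt; first by move=> k kt; apply: jts; rewrite inE kt orbT.
  have js : j \in s by apply: jts; rewrite mem_head.
  have [||u' [v' [Qu' Qv' uv']]] := co i j (mem_head _ _); first by rewrite inE js orbT.
    by move=> ij; rewrite ij js in iNs.
  exists (u * (u' + v') + v * u'), (v * v'); split.
  - by apply: (idealD iI); [apply: (idealMr _ iI) | apply: (idealMl _ iI)].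
  - move=> k; rewrite inE => /orP[/eqP ->|kt].
      exact: (idealMl _ (sI _ js)).
    apply: idealMr; last exact: Hv.
    by apply/sI/jts; rewrite inE kt orbT.
  - by rewrite -addrA -mulrDr -mulrDl uv uv' mul1r.
apply: IH => //; first by move=> j js; apply: sQ; rewrite inE js orbT.
by move=> j k js ks; apply: co; rewrite inE ?js ?ks orbT.
Qed.

Lemma index_le I n c (T : finType) (phi : OK K -> T) : is_ideal I -> index_ge I n ->
  I c -> (forall x y, phi x = phi y -> exists z, x - y = c * z) -> (n <= #|T|)%N.
Proof.
move=> II [S [f [<- f_inj]]] Ic phiP.
apply: (@leq_card _ _ (phi \o f)) => i j /= /phiP[z fz].
by apply: f_inj; rewrite fz; apply: (idealMr _ II).
Qed.

(* min(v_P(c), 2) when P contains c. *)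
Definition sq_exponent c P : nat := if `[< ideal_exp P 2 c >] then 2 else 1.

(** The ideals P or P^2, according to [sq_exponent], are pairwise comaximal and all contain [c]. The
    index of their intersection is at least the product of the bounds for each, and at most
    [#|T|]. *)
Lemma prod_norm_le c (s : seq (set (OK K)))
    (T : finType) (phi : OK K -> T) :
  (forall x y, phi x = phi y -> exists z, x - y = c * z) ->
  uniq s -> (forall P, P \in s -> nonzero_prime_ideal P /\ P c) ->
  (\prod_(P <- s) ideal_norm P ^ sq_exponent c P <= #|T|)%N.
Proof.
move=> phiP us sP.
pose Q P := if `[< ideal_exp P 2 c >] then ideal_exp P 2 else P.
have QI P : is_ideal P -> is_ideal (Q P) by rewrite /Q; case: ifP => // _; exact: is_ideal_exp.
have cQ P P' : is_ideal P -> is_ideal P' -> comaximal P P' -> comaximal (Q P) P'.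
  by move=> PI P'I; rewrite /Q; case: ifP => // _; exact: comaximal_exp2.
have capI : is_ideal [set x | forall P, P \in s -> Q P x].
  split=> [P /sP[/prime_is_ideal/QI[]]//|a x y Hx Hy P Ps].
  have [_] := QI _ (prime_is_ideal (sP _ Ps).1).
  by apply; [apply: Hx | apply: Hy].
have := @index_ge_bigcap _ s Q (fun P => (ideal_norm P ^ sq_exponent c P)%N).
move=> H; apply: (index_le capI (H _ us _) _ phiP) => [P /sP[PP _]|P P' /sP[PP _] /sP[P'P _] PP'|P /sP[PP Pc]].
- split; first exact/QI/prime_is_ideal.
  rewrite /Q /sq_exponent; case: ifP => _; first exact: index_ge_square.
  by rewrite expn1; exact: index_ge_norm.
- have PI := prime_is_ideal PP; have P'I := prime_is_ideal P'P.
  apply: (cQ) => //; first exact: QI.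
  apply/comaximalC/cQ => //; apply: comaximal_primes => //.
  by move=> P'P_; apply: PP'.
- by rewrite /Q; case: ifPn => [/asboolP|].
Qed.

(** * Primes containing a given element, ramification, and a criterion for non-Wieferich primes *)

Lemma finite_ideals_containing c : c != 0 -> finite_set [set I | is_ideal I /\ I c].
Proof.
move=> c0; have [T [phi phiP]] := finite_quotient c0.
(* An ideal containing [c] is a union of fibres of [phi], so a subset of the finite type [T]
   determines it. *)
pose f (A : {set T}) : set (OK K) := [set x | phi x \in A].
apply: (@sub_finite_set _ _ (f @` setT)); last exact/finite_image/finite_finset.
move=> I [II Ic]; exists [set t | `[< exists2 x, I x & phi x = t >]]%SET => //.
apply/seteqP; split=> x; rewrite /f /= finset.inE; last by move=> Ix; apply/asboolP; exists x.
move=> /asboolP[y Iy /esym/phiP[z xz]].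
rewrite -(subrK y x) xz; apply: (idealD II) => //; exact: (idealMr _ II).
Qed.

Lemma finite_primes_containing c : c != 0 ->
  finite_set [set P | nonzero_prime_ideal P /\ P c].
Proof.
move=> c0; apply: sub_finite_set (finite_ideals_containing c0).
by move=> P [PP Pc]; split=> //; exact: prime_is_ideal.
Qed.

(* If p lies in P^2, then O_K/p has a nonzero nilpotent element:
   x^i = x^j mod p with i < j for any x, and x - x^(j-i+1) is killed by its
   i-th power but does not lie in P^2 when x is in P and not in P^2. *)
Lemma ramified_discriminant (D : nat) P (p : nat) :
  (forall (p : nat) (y : OK K), prime p -> (exists m z, y ^+ m = p%:R * z) ->
    (exists z, y = p%:R * z) \/ (p %| D)%N) ->
  nonzero_prime_ideal P -> prime p -> ideal_exp P 2 p%:R -> P D%:R.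
Proof.
move=> HD PP pp Pp2; have PI := prime_is_ideal PP.
have PI2 := is_ideal_exp 2 PI.
have p0 : p%:R != 0 :> OK K.
  rewrite -(inj_eq val_inj) rmorph_nat rmorph0.
  by rewrite -(rmorph_nat (in_alg K)) fmorph_eq0 pnatr_eq0 -lt0n prime_gt0.
have [T [phi phiP]] := finite_quotient p0.
have [x [Px Px2]] := prime_neq_square PP.
have [i [j [ij xij]]] : exists i j : nat, (i < j)%N /\ phi (x ^+ i) = phi (x ^+ j).
  pose f (i : 'I_#|T|.+1) := phi (x ^+ i).
  have /injectivePn[i [j ij fij]] : ~~ injectiveb f.
    apply/injectiveP => /leq_card; by rewrite card_ord ltnn.
  have [lt|lt|e] := ltngtP i j; [by exists i, j | by exists j, i |].
  by rewrite (val_inj e) eqxx in ij.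
have {xij} [z xij] := phiP _ _ xij.
pose y := x - x ^+ (j - i).+1.
have yi : exists m z, y ^+ m = p%:R * z.
  exists i.+1, (z * (x * (1 - x ^+ (j - i)) ^+ i)).
  have yE : y = x * (1 - x ^+ (j - i)) by rewrite /y mulrBr mulr1 exprS.
  have xE : p%:R * z = x ^+ i * (1 - x ^+ (j - i)).
    by rewrite -xij mulrBr mulr1 -exprD subnKC // ltnW.
  rewrite mulrA xE yE exprMn !exprS; ring.
have y2 : ~ ideal_exp P 2 y.
  move=> y2; apply: Px2; rewrite -(subrK (x ^+ (j - i).+1) x).
  apply: (idealD PI2) => //; rewrite -subnSK // 2!exprS mulrA.
  by apply: (idealMr _ PI2); exact: mem_ideal_exp2.
have [[w yw]|pD] := HD p y pp yi.
  by case: y2; rewrite yw; exact: (idealMr _ PI2).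
rewrite -(divnK pD) natrM; apply: (idealMl _ PI).
exact: (ideal_exp2_sub PI).
Qed.

Lemma valuation_prime_below P : nonzero_prime_ideal P ->
  ~ ideal_exp P 2 (prime_below P)%:R -> valuation P (prime_below P)%:R = 1%N.
Proof.
move=> PP p2; have PI := prime_is_ideal PP; have [pp Pp] := prime_belowP PP.
rewrite /valuation; case: xgetP => [n _ [pn pn1]|/(_ 1%N)[]]; last first.
  split; last exact: p2.
  by change (ideal_exp P 1 (prime_below P)%:R); rewrite ideal_exp1.
apply/eqP; rewrite eqn_leq; apply/andP; split.
  rewrite leqNgt; apply/negP => n1; apply: p2.
  exact: (ideal_exp_sub PI n1).
by rewrite lt0n; apply/eqP => n0; apply: pn1; rewrite n0 ideal_exp1.
Qed.

(** Put m = N(P) - 1. If P^2 contained eta^m - 1, it would contain eta^(nm) - 1, which is eta^n - 1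
    times a sum of m powers of eta^n. Modulo P that sum is m, that is -1 since N(P) lies in P; it
    cancels, and P^2 would contain eta^n - 1. *)
Lemma non_wieferichP (eta : OK K) P n : nonzero_prime_ideal P -> (0 < n)%N ->
  P (eta ^+ n - 1) -> ~ ideal_exp P 2 (eta ^+ n - 1) -> non_wieferich eta P.
Proof.
move=> PP n0 Pn Pn2; have PI := prime_is_ideal PP.
have Pe : ~ P eta.
  move=> Pe; apply: (prime_not1 PP).
  have Pen : P (eta ^+ n) by rewrite -(prednK n0) exprS; exact: (idealMr _ PI).
  by have := idealB PI Pen Pn; rewrite opprB addrCA subrr addr0.
split; first exact: fermat_residue.
set m := (ideal_norm P).-1 => Pm2; apply: Pn2.
have [/= PN N1] := (ideal_norm_mem PP, ideal_norm_gt1 PP).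
have Pm : ~ P m%:R.
  move=> Pm; apply: (prime_not1 PP).
  have := idealB PI PN Pm; rewrite -(prednK (ltnW N1)) -/m.
  by rewrite -natrB ?leqnSn // subSnn.
have [P2I] := is_ideal_exp 2 PI.
have geo (x : OK K) k : x ^+ k - 1 = (\sum_(i < k) x ^+ i) * (x - 1).
  by rewrite mulrC -subrX1.
have Psum : ~ P (\sum_(i < m) (eta ^+ n) ^+ i).
  move=> Ps; apply: Pm; have Pd (i : 'I_m) : P ((eta ^+ n) ^+ i - 1).
    by rewrite -[X in _ - X](expr1n _ i); exact: ideal_expr_sub.
  have := idealB PI Ps (ideal_sum (index_enum _) PI Pd).
  rewrite sumrB opprB addrCA subrr addr0 sumr_const card_ord; exact.
move=> _; apply: (prime_primary PP Psum Pn).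
by rewrite -geo exprAC geo; apply: idealMl => //; exact: is_ideal_exp.
Qed.

End Primes.

(** * Counting new primes *)

Section Counting.
Variable R : realType.

(** * Sums over the divisors of an integer *)

Lemma sum_dvdn_indicator (e X : nat) : (0 < e)%N ->
  (\sum_(1 <= n < X.+1) (e %| n) = X %/ e)%N.
Proof.
move=> e0; elim: X => [|X IH]; first by rewrite big_geq // div0n.
by rewrite big_nat_recr //= IH divnS // addnC.
Qed.

(** Telescoping: 1/e^2 is at most 1/(e-1) - 1/e, used from e = 3 on, while the term e = 2 is kept
    exactly as 1/4 = 3/4 - 1/2. *)
Lemma sum_inv_square_le (m : nat) :
  \sum_(2 <= e < m.+1) (e%:R ^- 2 : R) <= 3 / 4.
Proof.
have [m1|m2] := ltnP m 2; first by rewrite big_geq //; lra.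
suff : \sum_(2 <= e < m.+1) (e%:R ^- 2 : R) <= 3 / 4 - m%:R^-1.
  by move=> /le_trans; apply; rewrite lerBlDr lerDl invr_ge0.
elim: m m2 => // m IH; rewrite ltnS leq_eqVlt => /orP[/eqP <-|m2].
  by rewrite big_nat1; lra.
rewrite big_nat_recr //=; last exact: ltnW.
apply: le_trans (lerD (IH m2) (lexx _)) _.
have m0 : 0 < m%:R :> R by rewrite ltr0n (ltn_trans _ m2).
have m10 : 0 < m.+1%:R :> R by rewrite ltr0n.
rewrite -addrA lerD2l addrC -lerBrDr opprK addrC.
have -> : m%:R^-1 - m.+1%:R^-1 = (m%:R * m.+1%:R)^-1 :> R.
  by rewrite -natr1 in m10 *; field; rewrite !gt_eqF.
rewrite expr2 lef_pV2 ?posrE ?mulr_gt0 //.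
by rewrite ler_pM2r // ler_nat.
Qed.

(** For n > 0 this is the sum of the proper divisors of n, divided by n. *)
Definition divisor_weight (n : nat) : R :=
  \sum_(2 <= e < n.+1 | (e %| n)%N) e%:R^-1.

Lemma divisor_weight_ge0 n : 0 <= divisor_weight n.
Proof. by apply: sumr_ge0 => e _; rewrite invr_ge0. Qed.

(** After exchanging the sums, e contributes 1/e for each of its at most X/e multiples. *)
Lemma sum_divisor_weight (X : nat) :
  \sum_(1 <= n < X.+1) divisor_weight n <= 3 / 4 * X%:R.
Proof.
have hE n : (1 <= n < X.+1)%N -> divisor_weight n =
    \sum_(2 <= e < X.+1) (e %| n)%N%:R * e%:R^-1.
  move=> /andP[n0 nX]; rewrite /divisor_weight (big_nat_widen _ _ X.+1) // big_mkcond /=.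
  apply: eq_bigr => e _; rewrite ltnS; case: (boolP (e %| n)%N) => en /=.
    by rewrite dvdn_leq // mul1r.
  by rewrite mul0r.
rewrite (eq_big_nat _ _ hE) exchange_big_nat /=.
apply: (@le_trans _ _ (\sum_(2 <= e < X.+1) X%:R * (e%:R ^- 2 : R))); last first.
  by rewrite -mulr_sumr mulrC ler_wpM2r // sum_inv_square_le.
rewrite big_nat_cond [leRHS]big_nat_cond; apply: ler_sum => e /andP[/andP[e2 _] _].
have e0 : (0 < e)%N by exact: ltn_trans e2.
rewrite -mulr_suml -natr_sum sum_dvdn_indicator //.
have eR : 0 < e%:R :> R by rewrite ltr0n.
rewrite exprS expr1 invfM mulrA ler_pM2r ?invr_gt0 // ler_pdivlMr //.
by rewrite -natrM ler_nat leq_divM.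
Qed.

(* Complementary divisors of n are distinct. *)
Lemma count_small_codivisors (G n : nat) :
  (\sum_(2 <= e < n.+1 | (e %| n) && (n %/ e <= G)) 1 <= G)%N.
Proof.
rewrite sum1_count -size_filter.
set s := seq.filter _ _.
have sP e : e \in s -> [/\ (e %| n)%N, (n %/ e <= G)%N, (0 < e)%N & (e <= n)%N].
  rewrite mem_filter mem_index_iota => /andP[/andP[en eG] /andP[e2 e_n]].
  by split=> //; apply: ltn_trans e2.
rewrite -(size_map (fun e => (n %/ e)%N)) -(size_iota 1 G).
apply: uniq_leq_size.
  rewrite map_inj_in_uniq ?filter_uniq ?iota_uniq // => e e' /sP[en _ e0 le] /sP[en' _ e0' _] nn.
  have n0 : (0 < n)%N by exact: leq_trans le.
  have q0 : (0 < n %/ e)%N by rewrite divn_gt0.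
  apply/eqP; rewrite -(eqn_pmul2l q0) {2}nn !divnK //.
move=> _ /mapP[e /sP[en eG e0 le] ->].
by rewrite mem_iota add1n ltnS eG divn_gt0 // le.
Qed.

(** In the application [U n] is the set of primes dividing eta^n - 1 exactly once, [l] is the
    logarithm of the norm and [L] is ln |s0 eta|. *)
Variables (A : choiceType) (U : nat -> {fset A}) (l : A -> R) (L C2 C5 : R).
Hypothesis l0 : forall P, 0 <= l P.
Hypothesis (L0 : 0 < L) (C20 : 0 <= C2).
Let S n := \sum_(P <- U n) l P.
Hypothesis U_upper : forall n, (0 < n)%N -> S n <= n%:R * L + C2.
Hypothesis U_lower : forall n, (0 < n)%N -> 15 / 16 * n%:R * L - C5 <= S n.
Hypothesis U_dvd : forall n m P, P \in U n -> P \in U m -> (0 < m < n)%N ->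
  exists2 e, (e %| n)%N && (1 < e)%N & P \in U (n %/ e).

Let good n := exists2 P, P \in U n & forall m, (0 < m < n)%N -> P \notin U m.

(** By [U_dvd] each P in [U n] also lies in some [U (n %/ e)] with e > 1, so [l P] occurs on the
    right; all other terms there are nonnegative. *)
Lemma not_good_sum n : (0 < n)%N -> ~ good n ->
  S n <= \sum_(2 <= e < n.+1 | (e %| n)%N) S (n %/ e).
Proof.
move=> n0 ng.
have UU P : P \in U n -> exists2 e, e \in [seq e <- index_iota 2 n.+1 | (e %| n)%N] & P \in U (n %/ e).
  move=> PU; have [m [m0 Pm]] : exists m, (0 < m < n)%N /\ P \in U m.
    apply: contrapT => H; apply: ng; exists P => // m mn.
    by apply/negP => Pm; apply: H; exists m.
  have [e /andP[en e1] Pe] := U_dvd PU Pm m0; exists e => //.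
  by rewrite mem_filter en mem_index_iota e1 ltnS dvdn_leq.
rewrite -big_filter /S; set s := seq.filter _ _ in UU *.
have -> : \sum_(e <- s) \sum_(P <- U (n %/ e)) l P =
    \sum_(P <- U n) \sum_(e <- s | P \in U (n %/ e)) l P +
    \sum_(e <- s) \sum_(P <- U (n %/ e) | P \notin U n) l P.
  rewrite (exchange_big_dep xpredT) //= -big_split /=; apply: eq_bigr => e _.
  rewrite (bigID (fun P => P \in U n)) /=; congr (_ + _).
  rewrite -big_filter -[RHS]big_filter; apply: perm_big; apply: uniq_perm.
  - exact/filter_uniq/fset_uniq.
  - exact/filter_uniq/fset_uniq.
  - by move=> P; rewrite !mem_filter andbC.
rewrite ler_wpDr //; first by apply: sumr_ge0 => e _; apply: sumr_ge0.
rewrite big_seq_cond [leRHS]big_seq_cond; apply: ler_sum => P /andP[/UU[e es Pe] _].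
rewrite (big_rem e) //= Pe lerDl; exact: sumr_ge0.
Qed.

(** Insert [U_upper] for each n/e. If n/e exceeds [G], then [C2] is at most (n/e) L / 16, which
    raises the factor 1 to 17/16; the at most [G] other divisors cost [C2] each. *)
Lemma not_good_weight (G n : nat) : 16 * C2 <= G%:R * L -> (0 < n)%N -> ~ good n ->
  15 / 16 * n%:R * L - C5 - G%:R * C2 <= 17 / 16 * n%:R * L * divisor_weight n.
Proof.
move=> GL n0 ng; rewrite lerBlDr; apply: le_trans (U_lower n0) _.
apply: le_trans (not_good_sum n0 ng) _.
apply: (@le_trans _ _ (\sum_(2 <= e < n.+1 | (e %| n)%N)
  (17 / 16 * n%:R * L * e%:R^-1 + C2 * (n %/ e <= G)%N%:R))).
  rewrite big_nat_cond [leRHS]big_nat_cond; apply: ler_sum => e /andP[/andP[e2 en] edn].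
  have e0 : (0 < e)%N by exact: ltn_trans e2.
  apply: le_trans (U_upper _) _; first by rewrite divn_gt0.
  have -> : 17 / 16 * n%:R * L * e%:R^-1 = (17 / 16) * (n %/ e)%N%:R * L.
    have -> : n%:R = (n %/ e)%N%:R * e%:R :> R by rewrite -natrM divnK.
    by field; rewrite pnatr_eq0 -lt0n.
  have [leG|gtG] := leqP (n %/ e) G.
    have : 0 <= (n %/ e)%N%:R * L by rewrite mulr_ge0 // ltW.
    by rewrite mulr1; lra.
  rewrite mulr0 addr0.
  have : G%:R * L <= (n %/ e)%N%:R * L by rewrite ler_pM2r // ler_nat ltnW.
  by lra.
rewrite big_split /= -!mulr_sumr -/(divisor_weight n) lerD2l mulrC.
rewrite ler_wpM2r // -natr_sum ler_nat.
apply: leq_trans (count_small_codivisors G n).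
rewrite [leqRHS]big_mkcondr; apply: leq_sum => e _.
by case: (n %/ e <= G)%N.
Qed.

Lemma many_good : exists n0 : nat, forall X : nat, exists s : seq nat,
  [/\ uniq s, forall n, n \in s -> (0 < n <= X)%N /\ good n
    & X%:R / 16 - n0%:R <= (size s)%:R :> R].
Proof.
have [G GL] : exists G : nat, 16 * C2 <= G%:R * L.
  exists (Num.bound (16 * C2 / L)); rewrite -ler_pdivrMr //.
  by apply: ltW; apply: archi_boundP; rewrite divr_ge0 ?mulr_ge0 // ltW.
pose C7 := (C5 + G%:R * C2) / L.
pose n0 := Num.bound (20 * `|C7|).
have n0P : 20 * C7 < n0%:R.
  apply: le_lt_trans (archi_boundP _); last by rewrite mulr_ge0.
  by rewrite ler_pM2l // ler_norm.
exists n0 => X.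
pose gd n := `[< good n >].
exists [seq n <- index_iota 1 X.+1 | gd n]; split.
- exact/filter_uniq/iota_uniq.
- by move=> n; rewrite mem_filter mem_index_iota ltnS => /andP[/asboolP].
(* Since 20 [C7] is at most n, the weight is at least (15/16 - 1/20) / (17/16) = 71/85, more than
   4/5. *)
have wB n : (n0 <= n)%N -> (0 < n)%N -> ~ good n -> 4 / 5 <= divisor_weight n.
  move=> n0n np ng; have := not_good_weight GL np ng.
  have np' : 0 < n%:R :> R by rewrite ltr0n.
  have nC : 20 * C7 <= n%:R by apply: (le_trans (ltW n0P)); rewrite ler_nat.
  have CE : C5 + G%:R * C2 = C7 * L by rewrite /C7 divfK // gt_eqF.
  rewrite -addrA -opprD CE.
  have -> : 15 / 16 * n%:R * L - C7 * L = (15 / 16 * n%:R - C7) * L by ring.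
  have -> : 17 / 16 * n%:R * L * divisor_weight n = 17 / 16 * (n%:R * divisor_weight n) * L by ring.
  rewrite ler_pM2r // => H.
  rewrite -(ler_pM2l np') mulrC; lra.
have tot : X%:R = \sum_(1 <= n < X.+1) 1 :> R.
  by rewrite sumr_const_nat subn1.
have gdE : (size [seq n <- index_iota 1 X.+1 | gd n])%:R =
    \sum_(1 <= n < X.+1) (gd n)%:R :> R.
  by rewrite size_filter -sum1_count natr_sum big_mkcond /=; apply: eq_bigr => n _; case: gd.
have n0E : \sum_(1 <= n < X.+1) (n < n0)%N%:R <= n0%:R :> R.
  rewrite -natr_sum ler_nat; apply: (@leq_trans (minn X n0)); last exact: geq_minr.
  elim: X {tot gdE} => [|X IH]; first by rewrite big_geq.
  by rewrite big_nat_recr //=; move: IH; case: ltnP => /=; lia.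
(* An n beyond [n0] that is not good has 5/4 of its weight at least 1. The mean weight is at most
   3/4, so at most 15/16 of the n are of this kind. *)
have : \sum_(1 <= n < X.+1) (1 - (gd n)%:R - (n < n0)%N%:R) <=
    \sum_(1 <= n < X.+1) (5 / 4 * divisor_weight n) :> R.
  rewrite big_nat_cond [leRHS]big_nat_cond; apply: ler_sum => n /andP[/andP[np _] _].
  have := divisor_weight_ge0 n; rewrite /gd; case: asboolP => gn /=.
    by case: ltnP => _ /= w0; lra.
  by case: ltnP => [_|/wB/(_ np gn)] /=; lra.
rewrite -mulr_sumr !sumrB -tot -gdE.
have := sum_divisor_weight X; lra.
Qed.

(** Let X be the integer part of (ln x - C2) / L. Elements of [U n] with n at most X satisfy the
    bound by [U_upper], and each good n yields an element whose first occurrence is at n, so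
    different n yield different elements. *)
Lemma count_good : exists2 c : R, 0 < c & \forall x \near +oo,
  exists2 T : {fset A}, (forall P, P \in T -> l P <= ln x /\ exists2 n, (0 < n)%N & P \in U n)
    & c * ln x <= #|` T|%:R.
Proof.
have [n0 goods] := many_good.
exists (32 * L)^-1; first by rewrite invr_gt0 mulr_gt0.
(* Once ln x reaches [M], half of ln x / (16 L) absorbs the additive constants; the 1/16 comes from
   rounding down to X. *)
pose M := 32 * L * (C2 / L / 16 + 1 / 16 + n0%:R).
have M0 : 0 <= M.
  by rewrite !mulr_ge0 ?addr_ge0 ?mulr_ge0 ?divr_ge0 ?invr_ge0 // ltW.
near=> x.
have x0 : 0 < x by near: x; exact: nbhs_pinfty_gt.
have xE : expR (M + C2) <= x by near: x; apply: nbhs_pinfty_ge; exact: num_real.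
have xM : M + C2 <= ln x by rewrite -[M + C2]expRK ler_ln ?posrE ?expR_gt0.
have y0 : 0 <= (ln x - C2) / L by apply: divr_ge0; [lra | exact: ltW].
pose X := Num.truncn ((ln x - C2) / L).
have /andP[X1 X2] : X%:R <= (ln x - C2) / L < X.+1%:R := truncn_itv y0.
have [s [us sP ss]] := goods X.
(* [None] serves the indices outside [s], as [A] has no default element. *)
have /choice[p pP] (n : nat) : exists P : option A, n \in s ->
    exists2 Q, P = Some Q & Q \in U n /\ forall m, (0 < m < n)%N -> Q \notin U m.
  have [ns|ns] := boolP (n \in s); last by exists None.
  by have [_ [Q QU Qm]] := sP n ns; exists (Some Q) => _; exists Q.
pose T := [fset P in pmap p s]%fset.
exists T => [P|].
  rewrite !inE mem_pmap => /mapP[n ns Pn].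
  have [Q] := pP n ns; rewrite -Pn => -[<-] [PU _].
  have [/andP[np nX] _] := sP n ns; split; last by exists n.
  have lS : l P <= S n.
    rewrite /S (big_rem P) //= lerDl; exact: sumr_ge0.
  apply: le_trans lS _; apply: le_trans (U_upper np) _.
  rewrite -lerBrDr -ler_pdivlMr //; apply: le_trans X1.
  by rewrite ler_nat.
have -> : #|` T| = size s.
  have allS : all isSome (map p s).
    by rewrite all_map; apply/allP => n /pP[Q /= -> _].
  have up : uniq (pmap p s).
    apply: (map_uniq (f := Some)); rewrite pmapS_filter map_inj_in_uniq ?filter_uniq //.
    move=> m n; rewrite !mem_filter => /andP[_ ms] /andP[_ ns] pmn.
    have [Q] := pP m ms; have [Q'] := pP n ns.
    rewrite pmn => -> [QU Qm] [<-] [Q'U Q'm].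
    have [/andP[m0 _] _] := sP m ms; have [/andP[np _] _] := sP n ns.
    have [lt|lt|//] := ltngtP m n.
      by have := Qm m; rewrite m0 lt Q'U => /(_ isT).
    by have := Q'm n; rewrite np lt QU => /(_ isT).
  by rewrite card_fseq undup_id // size_pmap; apply/eqP; rewrite -all_count -all_map.
apply: le_trans ss; rewrite -natr1 in X2.
rewrite mulrC ler_pdivrMr ?mulr_gt0 //.
have E : (ln x - C2) / L = ln x / L - C2 / L by rewrite mulrBl.
have lE : ln x = ln x / L * L by rewrite divfK // gt_eqF.
have : M <= ln x by apply: le_trans xM; rewrite lerDl.
rewrite /M {1}lE [32 * L * _]mulrAC ler_pM2r // => H.
rewrite {1}lE mulrA ler_pM2r //.
lra.
Unshelve. all: by end_near.
Qed.

End Counting.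

(** * Consequences of the ABC conjecture *)

Section Bounds.
Variables (R : realType) (K : fieldExtType rat).
Implicit Types (P : set (OK K)) (n : nat).

Let lognorm P : R := ln (ideal_norm P)%:R.

Lemma lognorm_ge0 P : 0 <= lognorm P.
Proof.
rewrite /lognorm; case: (ideal_norm P) => [|n]; first by rewrite ln0.
by rewrite ln_ge0 // ler1n.
Qed.

Lemma ln_prod_exp (T : eqType) (s : seq T) (f : T -> R) (k : T -> nat) :
  (forall i, i \in s -> 0 < f i) ->
  0 < \prod_(i <- s) f i ^+ k i /\
  ln (\prod_(i <- s) f i ^+ k i) = \sum_(i <- s) (k i)%:R * ln (f i).
Proof.
elim: s => [|i s IH] sf; first by rewrite !big_nil ln1.
have [|p0 lp] := IH; first by move=> j js; apply: sf; rewrite inE js orbT.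
have fi : 0 < f i by apply: sf; rewrite mem_head.
rewrite !big_cons; split; first by rewrite mulr_gt0 ?exprn_gt0.
by rewrite lnM ?posrE ?exprn_gt0 // lp lnXn // mulr_natl.
Qed.

Lemma normr_normc (z : R[i]) : `|z| = (normc z)%:C.
Proof. by []. Qed.

Lemma normcXn (z : R[i]) n : normc (z ^+ n) = normc z ^+ n.
Proof.
elim: n => [|n IH]; first by rewrite !expr0 normc1.
by rewrite !exprS normcM IH.
Qed.

Lemma finite_arch_places : finite_set (@arch_places R K).
Proof.
have [e [b [_ all_e _ _]]] := integral_basis K R[i].
apply: (@sub_finite_set _ _ ((fun i x => normc (e i x)) @` setT)); last first.
  exact/finite_image/finite_finset.
move=> _ [s ->]; have [i si] := all_e s; exists i => //.
by apply/funext => x; rewrite si.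
Qed.

Variables (eta : OK K) (s0 : {rmorphism K -> R[i]}).
Hypothesis hs0 : 1 < normc (s0 (val eta)).

Let A : R := normc (s0 (val eta)).

Lemma conjugate_gt0 : 0 < A. Proof. exact: lt_trans hs0. Qed.

Lemma eta_expr_neq1 n : (0 < n)%N -> eta ^+ n - 1 != 0.
Proof.
move=> n0; rewrite subr_eq0; apply/eqP => e1.
have : 1 < normc (s0 (val eta)) ^+ n by rewrite exprn_egt1 // -lt0n.
rewrite -normcXn -!rmorphXn e1 !rmorph1 normc1 ltxx //.
Qed.

(** The conjugate of eta^n - 1 at [s0] is at most 1 + A^n, hence 2 A^n, and every other one is at
    most 2; their product bounds the cardinal in [prod_norm_le]. *)
Lemma norm_upper n (s : seq (set (OK K))) :
  (forall s : {rmorphism K -> R[i]}, ~ s =1 s0 -> normc (s (val eta)) < 1) ->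
  (0 < n)%N -> uniq s ->
  (forall P, P \in s -> nonzero_prime_ideal P /\ P (eta ^+ n - 1)) ->
  \sum_(P <- s) (sq_exponent (eta ^+ n - 1) P)%:R * lognorm P <=
    n%:R * ln A + (\dim {:K})%:R * ln 2.
Proof.
move=> hs n0 us sP; have c0 := eta_expr_neq1 n0.
have [e [b [e_inj all_e bf bs]]] := integral_basis K R[i].
have [T [phi [phiP]]] := finite_index bf bs c0.
set c := eta ^+ n - 1 => NT.
have [k0 s0E] := all_e s0.
have A1 : 1 <= A ^+ n by rewrite exprn_ege1 // ltW.
have Tle : #|T|%:R <= 2 ^+ (\dim {:K}) * A ^+ n.
  rewrite -lecR rmorph_nat -NT normr_prod.
  apply: (@le_trans _ _ (\prod_k (2 * (if k == k0 then A ^+ n else 1)%:C))).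
    apply: ler_prod => k _; rewrite normr_ge0 andTb.
    have -> : val c = val eta ^+ n - 1 by rewrite rmorphB rmorphXn rmorph1.
    rewrite rmorphB rmorphXn rmorph1 mulr_natl mulr2n.
    apply: le_trans (ler_normB _ _) _; rewrite normr1 normrX normr_normc -rmorphXn.
    have [->|kk0] := eqVneq k k0.
      by rewrite -s0E lerD2l -(rmorph1 (real_complex R)) lecR.
    rewrite lerD2r lecR exprn_ile1 //.
      by case: (e k _) => x y; exact: sqrtr_ge0.
    apply/ltW/hs => kE; move/eqP: kk0; apply; apply: e_inj => x.
    by rewrite kE s0E.
  rewrite big_split /= prodr_const card_ord -rmorph_prod -big_mkcond big_pred1_eq.
  have E2 : ((2 : R) ^+ (\dim {:K}))%:C = 2 ^+ (\dim {:K}) :> R[i].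
    by rewrite rmorphXn rmorph_nat.
  by rewrite -E2 -rmorphM.
have fpos P : P \in s -> 0 < (ideal_norm P)%:R :> R.
  by move=> /sP[PP _]; rewrite ltr0n ltnW // ideal_norm_gt1.
have [p0 <-] := ln_prod_exp (sq_exponent c) fpos.
have -> : n%:R * ln A + (\dim {:K})%:R * ln 2 = ln (2 ^+ (\dim {:K}) * A ^+ n).
  by rewrite lnM ?posrE ?exprn_gt0 ?conjugate_gt0 // !lnXn ?conjugate_gt0 // !mulr_natl addrC.
rewrite ler_ln ?posrE ?mulr_gt0 ?exprn_gt0 ?conjugate_gt0 //; apply: le_trans Tle.
have := prod_norm_le phiP us sP; rewrite -(ler_nat R); apply: le_trans.
by rewrite natr_prod (eq_bigr _ (fun P _ => natrX _ _ _)).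
Qed.

Hypothesis eta_unit : eta \is a GRing.unit.

Definition primes_over n : {fset (set (OK K))} :=
  fset_set [set P | nonzero_prime_ideal P /\ P (eta ^+ n - 1)].

Lemma mem_primes_over n P : (0 < n)%N ->
  P \in primes_over n <-> nonzero_prime_ideal P /\ P (eta ^+ n - 1).
Proof.
move=> n0; rewrite in_fset_set ?inE //.
exact: finite_primes_containing (eta_expr_neq1 n0).
Qed.

Lemma finite_abs_le1 P a : finite_abs R P a <= 1.
Proof.
rewrite /finite_abs; case: ifP => // _.
case: (ideal_norm P) => [|N].
  by case: (valuation P a) => [|v]; rewrite ?expr0 ?invr1 // exprS mul0r invr0.
by rewrite invf_le1 ?exprn_gt0 // exprn_ege1 // ler1n.
Qed.

Lemma finite_abs1 P : nonzero_prime_ideal P -> finite_abs R P 1 = 1.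
Proof.
move=> PP; rewrite /finite_abs oner_eq0.
suff -> : valuation P 1 = 0%N by rewrite expr0 invr1.
have PI := prime_is_ideal PP.
rewrite /valuation; case: xgetP => [v _ [v1 _]|/(_ 0%N)[]]; last first.
  split=> // P1; apply: (prime_not1 PP).
  exact: (ideal_mul_subl PI P1).
apply/eqP; rewrite -leqn0 leqNgt; apply/negP => v0; apply: (prime_not1 PP).
rewrite -(ideal_exp1 PI); exact: (ideal_exp_sub PI v0).
Qed.

(** The argument 1 makes every finite factor equal to 1 and every archimedean factor at least 1, and
    the place of [s0] contributes at least A^n. The degree cancels the exponent in the height. *)
Lemma height_lower n : (0 < n)%N ->
  n%:R * ln A <= (\dim {:K})%:R * ln (height R (eta ^+ n - 1) 1 (- eta ^+ n)) /\
  0 < height R (eta ^+ n - 1) 1 (- eta ^+ n).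
Proof.
move=> n0; rewrite /height fsbig1 ?mul1r; last first.
  move=> P PP; rewrite finite_abs1 //.
  rewrite (max_idPr (finite_abs_le1 _ _)) (max_idPl _) //.
  exact: finite_abs_le1.
rewrite fsbig_finite; last exact: finite_arch_places.
pose G (w : K -> R) : R := Num.max (Num.max (arch_abs w (eta ^+ n - 1)) (arch_abs w 1))
  (arch_abs w (- eta ^+ n)).
rewrite -[\big[_/_]_(w <- _) _]/(\prod_(w <- fset_set (@arch_places R K)) G w).
have G1 w : w \in fset_set (@arch_places R K) -> 1 <= G w.
  rewrite in_fset_set ?inE; last exact: finite_arch_places.
  move=> [s ->]; rewrite /G !le_max; apply/orP; left; apply/orP; right.
  have w1 : normc (s (val (1 : OK K))) = 1 by rewrite !rmorph1 normc1.
  by rewrite /arch_abs; case: ifP => _; rewrite w1 ?expr1n.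
pose w0 : K -> R := fun x => normc (s0 x).
have w0in : w0 \in fset_set (@arch_places R K).
  rewrite in_fset_set ?inE; last exact: finite_arch_places.
  by exists s0.
have Gw0 : A ^+ n <= G w0.
  rewrite /G le_max; apply/orP; right; rewrite /arch_abs.
  have -> : w0 (val (- eta ^+ n)) = A ^+ n.
    change (normc (s0 (val (- eta ^+ n))) = A ^+ n).
    by rewrite !rmorphN !rmorphXn normcN normcXn.
  (* At a complex place the absolute value is squared, and A^n is at least 1. *)
  by case: ifP => // _; rewrite expr2 ler_peMl ?exprn_ge0 ?exprn_ege1 // ltW // conjugate_gt0.
have prodG : A ^+ n <= \prod_(w <- fset_set (@arch_places R K)) G w.
  rewrite (big_rem w0) //=; apply: le_trans Gw0 _.
  rewrite ler_peMr //; first exact: le_trans (G1 _ w0in).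
  rewrite big_seq; apply: (big_ind (fun x : R => 1 <= x)) => //.
    by move=> x y; exact: mulr_ege1.
  by move=> w /mem_rem/G1.
have An0 : 0 < A ^+ n by rewrite exprn_gt0 // conjugate_gt0.
have p0 := lt_le_trans An0 prodG.
split; last exact: powR_gt0.
rewrite ln_powR mulrA divff ?mul1r; last first.
  by rewrite pnatr_eq0 -lt0n adim_gt0.
by rewrite mulr_natl -lnXn ?conjugate_gt0 // ler_ln.
Qed.

(** As [eta] is a unit, only primes containing eta^n - 1 occur. Their exponent is 1 unless they
    contain the discriminant [D]; the latter belong to a finite set independent of n, whose total
    contribution is the constant. *)
Lemma radical_upper : exists C1 : R, forall n, (0 < n)%N ->
  (\dim {:K})%:R * ln (radical R ((eta ^+ n - 1) * 1 * - eta ^+ n)) <=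
    C1 + \sum_(P <- primes_over n) lognorm P /\
  0 < radical R ((eta ^+ n - 1) * 1 * - eta ^+ n).
Proof.
have [D D0 DP] := discriminant_exists K.
have D0' : D%:R != 0 :> OK K.
  rewrite -(inj_eq val_inj) rmorph_nat rmorph0.
  by rewrite -(rmorph_nat (in_alg K)) fmorph_eq0 pnatr_eq0.
pose Ram := fset_set [set P | nonzero_prime_ideal P /\ P (D%:R : OK K)].
pose v P : R := (valuation P (prime_below P)%:R)%:R.
exists (\sum_(P <- Ram) v P * lognorm P) => n n0.
rewrite /radical.
have -> : [set P | nonzero_prime_ideal P /\ P ((eta ^+ n - 1) * 1 * - eta ^+ n)] =
    [set P | nonzero_prime_ideal P /\ P (eta ^+ n - 1)].
  apply/seteqP; split=> P [PP Pc]; split=> //.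
    move: Pc; rewrite mulr1 => /(prime_mul PP)[//|Pu].
    by case: (prime_unit PP _ Pu); rewrite unitrN unitrX.
  by rewrite mulr1; apply: idealMr => //; exact: prime_is_ideal.
rewrite fsbig_finite; last exact: finite_primes_containing (eta_expr_neq1 n0).
rewrite -/(primes_over n).
have fpos P : P \in primes_over n -> 0 < (ideal_norm P)%:R :> R.
  by move=> /(mem_primes_over _ n0)[PP _]; rewrite ltr0n ltnW // ideal_norm_gt1.
have [p0 lnE] := ln_prod_exp (fun P => valuation P (prime_below P)%:R) fpos.
split; last exact: powR_gt0.
rewrite ln_powR mulrA divff ?mul1r; last first.
  by rewrite pnatr_eq0 -lt0n adim_gt0.
rewrite lnE.
apply: (@le_trans _ _ (\sum_(P <- primes_over n)
    ((if P \in Ram then v P * lognorm P else 0) + lognorm P))).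
  rewrite big_seq [leRHS]big_seq; apply: ler_sum => P Pn.
  have [PP _] := (mem_primes_over P n0).1 Pn.
  case: ifP => PR; first by rewrite lerDl lognorm_ge0.
  rewrite valuation_prime_below // ?mul1r ?add0r // => p2.
  move/negP: PR; apply; rewrite in_fset_set ?inE; last exact: finite_primes_containing.
  split=> //; apply: (ramified_discriminant DP PP _ p2).
  by have [] := prime_belowP PP.
rewrite big_split /= lerD2r -big_mkcond /=.
have -> : \sum_(P <- primes_over n | P \in Ram) v P * lognorm P =
    \sum_(P <- Ram | P \in primes_over n) v P * lognorm P.
  rewrite -big_filter -[RHS]big_filter; apply: perm_big; apply: uniq_perm.
  - exact/filter_uniq/fset_uniq.
  - exact/filter_uniq/fset_uniq.
  - by move=> P; rewrite !mem_filter andbC.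
rewrite [leRHS](bigID (fun P => P \in primes_over n)) /= lerDl.
by apply: sumr_ge0 => P _; rewrite mulr_ge0 ?lognorm_ge0 // ler0n.
Qed.

(** Epsilon is 1/31, giving the exponent 32/31: twice the resulting bound minus that of [norm_upper]
    leaves the coefficient 2 (31/32) - 1 = 15/16. *)
Lemma abc_lower : abc_conjecture R K -> exists C : R, forall n, (0 < n)%N ->
  n%:R * ln A <= C + 32 / 31 * \sum_(P <- primes_over n) lognorm P.
Proof.
move=> /(_ (1 / 31)) [|C abc]; first by lra.
have [C1 C1P] := radical_upper.
exists ((\dim {:K})%:R * ln C + 32 / 31 * C1) => n n0.
have [hl h0] := height_lower n0; have [ru r0] := C1P n n0.
have := abc (eta ^+ n - 1) 1 (- eta ^+ n) (eta_expr_neq1 n0) (oner_neq0 _).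
rewrite oppr_eq0 expf_eq0 n0 /=.
have -> : eta != 0 by apply: contraTneq eta_unit => ->; rewrite unitr0.
rewrite subrK subrr => /(_ isT (erefl _)) H.
have rp : 0 < radical R ((eta ^+ n - 1) * 1 * - eta ^+ n) `^ (1 + 1 / 31) by exact: powR_gt0.
(* The positive height forces [C] to be positive, so logarithms may be taken. *)
have C0 : 0 < C by rewrite -(pmulr_lgt0 _ rp); exact: lt_le_trans H.
move: H; rewrite -ler_ln ?posrE ?mulr_gt0 // lnM ?posrE // ln_powR => H.
have d0 : 0 <= (\dim {:K})%:R :> R by exact: ler0n.
have := ler_wpM2l d0 H; rewrite mulrDr => {}H.
apply: le_trans hl _; apply: le_trans H _.
rewrite mulrCA -addrA lerD2l -mulrDr.
have -> : 1 + 1 / 31 = 32 / 31 :> R by lra.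
by rewrite ler_pM2l //; lra.
Qed.

End Bounds.

(** * Primes dividing [eta ^+ n - 1] exactly once *)

Section SquarefreePart.
Variables (K : fieldExtType rat) (R : realType) (eta : OK K).

Definition simple_primes n : {fset (set (OK K))} :=
  [fset P in primes_over eta n | ~~ `[< ideal_exp P 2 (eta ^+ n - 1) >]]%fset.

(** Two minus [sq_exponent] is the indicator of exact divisibility. The ABC conjecture bounds the
    first sum from below, the norm bounds the second from above. *)
Lemma simple_primes_sum n (f : set (OK K) -> R) :
  \sum_(P <- simple_primes n) f P =
  2 * (\sum_(P <- primes_over eta n) f P) -
  \sum_(P <- primes_over eta n) (sq_exponent (eta ^+ n - 1) P)%:R * f P.
Proof.
rewrite mulr_sumr -sumrB.
transitivity (\sum_(P <- primes_over eta n | ~~ `[< ideal_exp P 2 (eta ^+ n - 1) >]) f P).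
  rewrite -[RHS]big_filter; apply: perm_big; apply: uniq_perm.
  - exact: fset_uniq.
  - exact/filter_uniq/fset_uniq.
  - by move=> P; rewrite mem_filter !inE andbC.
rewrite big_mkcond; apply: eq_bigr => P _.
by rewrite /sq_exponent; case: asboolP => _ /=; lra.
Qed.

Lemma expr_sub1_dvd (x : OK K) m n : (m %| n)%N ->
  exists z, x ^+ n - 1 = z * (x ^+ m - 1).
Proof.
move=> /dvdnP[q ->]; exists (\sum_(i < q) (x ^+ m) ^+ i).
by rewrite mulnC exprM mulrC -subrX1.
Qed.

(* The order of eta modulo P divides both n and m. *)
Lemma order_dvd P n m : nonzero_prime_ideal P -> P (eta ^+ n - 1) ->
  P (eta ^+ m - 1) -> (0 < m < n)%N ->
  exists k, [/\ (k %| n)%N, (0 < k < n)%N & P (eta ^+ k - 1)].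
Proof.
move=> PP Pn Pm /andP[m0 mn]; have PI := prime_is_ideal PP.
have exk : exists k, (0 < k)%N && `[< P (eta ^+ k - 1) >].
  by exists m; rewrite m0; apply/asboolP.
case: (ex_minnP exk) => k /andP[k0 /asboolP Pk] kmin; exists k; split=> //; last first.
  rewrite k0 (leq_ltn_trans _ mn) //; apply: kmin; rewrite m0.
  exact/asboolP.
apply/negPn/negP => kn; have r0 : (0 < n %% k)%N by rewrite lt0n.
suff Pr : P (eta ^+ (n %% k) - 1).
  have := kmin (n %% k)%N; rewrite r0 /= => /(_ (asboolT Pr)).
  by rewrite leqNgt ltn_mod k0.
have [z zE] := expr_sub1_dvd eta (dvdn_mull (n %/ k) (dvdnn k)).
have -> : eta ^+ (n %% k) - 1 = (eta ^+ n - 1) -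
    eta ^+ (n %% k) * (eta ^+ (n %/ k * k) - 1).
  by rewrite {2}(divn_eq n k) exprD; ring.
apply: (idealB PI) => //; rewrite zE mulrA; exact: idealMl.
Qed.

End SquarefreePart.

Theorem theorem1p0p2 (R : realType) (K : fieldExtType rat)
    (habc : abc_conjecture R K)
    (eta : OK K) (heta : eta \is a GRing.unit)
    (s0 : {rmorphism K -> R[i]}) (hs0 : 1 < normc (s0 (val eta)))
    (hs : forall s : {rmorphism K -> R[i]},
       ~ s =1 s0 -> normc (s (val eta)) < 1) :
  exists2 c : R, 0 < c &
    \forall x \near +oo,
      exists2 S : {fset (set (OK K))},
        (forall P, P \in S ->
           [/\ nonzero_prime_ideal P, (ideal_norm P)%:R <= x
             & non_wieferich eta P])
        & c * ln x <= #|` S|%:R.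
Proof.
pose L := ln (normc (s0 (val eta))).
pose C2 := (\dim {:K})%:R * ln 2 : R.
have L0 : 0 < L by rewrite ln_gt0.
have C20 : 0 <= C2 by rewrite mulr_ge0 // ln_ge0 // ler1n.
pose ell (P : set (OK K)) : R := ln (ideal_norm P)%:R.
have ell0 (P : set (OK K)) : 0 <= ell P := lognorm_ge0 R P.
have inF n P : (0 < n)%N -> P \in primes_over eta n <->
    nonzero_prime_ideal P /\ P (eta ^+ n - 1).
  exact: (mem_primes_over hs0).
have inU n P : (0 < n)%N -> P \in simple_primes eta n <->
    [/\ nonzero_prime_ideal P, P (eta ^+ n - 1) & ~ ideal_exp P 2 (eta ^+ n - 1)].
  move=> n0; rewrite !inE /=; split=> [/andP[/(inF _ _ n0)[PP Pn] /asboolPn //]|[PP Pn P2]].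
  by apply/andP; split; [apply/inF | apply/asboolPn].
have up n : (0 < n)%N -> \sum_(P <- primes_over eta n)
    (sq_exponent (eta ^+ n - 1) P)%:R * ell P <= n%:R * L + C2.
  move=> n0; apply: (norm_upper hs0 hs n0); first exact: fset_uniq.
  by move=> P /(inF _ _ n0).
have [C low] := abc_lower hs0 heta habc.
have U_upper n : (0 < n)%N -> \sum_(P <- simple_primes eta n) ell P <= n%:R * L + C2.
  move=> n0; apply: le_trans (up n n0); rewrite simple_primes_sum.
  (* Termwise, 2 is at most twice the exponent, which is 1 or 2. *)
  rewrite lerBlDr mulr_sumr -big_split /=; apply: ler_sum => P _.
  by have := ell0 P; rewrite /sq_exponent; case: ifP => _; lra.
have U_lower n : (0 < n)%N -> 15 / 16 * n%:R * L - (31 / 16 * C + C2) <=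
    \sum_(P <- simple_primes eta n) ell P.
  move=> n0; have := up n n0; have := low n n0; rewrite simple_primes_sum -/L.
  rewrite -/ell; lra.
have U_dvd n m P : P \in simple_primes eta n -> P \in simple_primes eta m ->
    (0 < m < n)%N ->
    exists2 e, (e %| n)%N && (1 < e)%N & P \in simple_primes eta (n %/ e).
  move=> Pn Pm /[dup] mn /andP[m0 lt]; have n0 := ltn_trans m0 lt.
  have [PP Pn1 Pn2] := (inU _ _ n0).1 Pn; have [_ Pm1 _] := (inU _ _ m0).1 Pm.
  have [k [kn /andP[k0 ltk] Pk]] := order_dvd PP Pn1 Pm1 mn.
  (* This makes [n %/ e] equal to [k]. The square of P cannot contain eta^k - 1, which divides eta^n
     - 1. *)
  exists (n %/ k)%N.
    by rewrite ltn_divRL // mul1n ltk andbT -{2}(divnK kn) dvdn_mulr.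
  have -> : (n %/ (n %/ k) = k)%N by rewrite -{1}(divnK kn) mulKn // divn_gt0 // dvdn_leq.
  apply/inU => //; split=> // Pk2; apply: Pn2.
  have [z ->] := expr_sub1_dvd eta kn.
  by apply: idealMl => //; exact/is_ideal_exp/prime_is_ideal.
have [c c0 cE] := count_good ell0 L0 C20 U_upper U_lower U_dvd.
exists c => //; apply: filterS2 cE (nbhs_pinfty_gt (num_real 0)) => x [T TP Tc] x0.
exists T => // P /TP[ellP [n n0 /(inU _ _ n0)[PP Pn Pn2]]]; split=> //.
  have N0 : 0 < (ideal_norm P)%:R :> R by rewrite ltr0n ltnW // ideal_norm_gt1.
  by rewrite -ler_ln ?posrE.
exact: (non_wieferichP PP n0).
Qed.
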